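(* Let $d_1=d_2=1$, and let $0<\lambda_1<1<\lambda_2$ and $t>0$ be such that $\frac{\lambda_1^t+\lambda_2^t}{2}<1$ (this implies $\lambda_1\lambda_2<1$). Let $\phi(x)=x^t$ for $x\ge1$ and define $h(\epsilon)=\int\phi(x)\,d\mu_{\lambda_1+\epsilon,\lambda_2}(x)$ for $|\epsilon|$ small. Then $h$ is infinitely differentiable at $0$ and the derivatives coincide with the formal derivatives: for every $l\in\mathbb{N}$, $l\ge1$, $$h^{(l)}(0)=\int_{\Sigma}\frac{d^l}{d\epsilon^l}\big(\phi\circ X(\epsilon)\big)\Big|_{\epsilon=0}\,d\nu=\int_{\Sigma}\ \sum_{k_1+2k_2+\cdots+lk_l=l}L(k_1,\dots,k_l)\,\phi^{(k)}(X)\prod_{j=1}^{l}\big(X^{(j)}\big)^{k_j}\,d\nu,$$ where the sum is over all non-negative integers $k_1,\dots,k_l$ with $k_1+2k_2+\cdots+lk_l=l$, $k:=k_1+\cdots+k_l$, and $L(k_1,\dots,k_l):=\frac{l!}{k_1!(1!)^{k_1}\cdots k_l!(l!)^{k_l}}$.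
   Context: For $0<a<1<b$ with $ab<1$, $\mu_{a,b}$ denotes the unique stationary measure of the iterated function system $x\mapsto ax+1$, $x\mapsto bx+1$ with probabilities $(\frac12,\frac12)$, i.e. the unique Borel probability measure $\mu$ on $\mathbb{R}$ equal to $\frac12$ of its push-forward by the first map plus $\frac12$ of its push-forward by the second map. It gives full mass to $[1,\infty)$. $\Sigma=\{1,2\}^{\mathbb{N}}$ with elements $(i_1,i_2,\dots)$, and $\nu=(\frac12,\frac12)^{\mathbb{N}}$ is the Bernoulli measure on $\Sigma$. For $|\epsilon|$ small enough that $0<\lambda_1+\epsilon<1$ and $(\lambda_1+\epsilon)\lambda_2<1$, put $\lambda_1(\epsilon)=\lambda_1+\epsilon$, $\lambda_2(\epsilon)=\lambda_2$ and $$X(\epsilon)=\sum_{m=0}^{\infty}\lambda_{i_1}(\epsilon)\cdots\lambda_{i_m}(\epsilon)$$ (empty product $=1$), which converges $\nu$-almost everywhere and has law $\mu_{\lambda_1+\epsilon,\lambda_2}$; $X:=X(0)$. The random variable $X^{(j)}$, $j\ge1$, is the (term by term) $j$-th derivative of $X(\epsilon)$ at $\epsilon=0$: $$X^{(j)}=\frac{j!}{\lambda_1^j}\sum_{m=1}^{\infty}\lambda_{i_1}\cdots\lambda_{i_m}\binom{o(m)}{j},$$ where $o(m)$ is the number of $1$'s among $i_1,\dots,i_m$, and $\binom{n}{k}=0$ if $k>n$. *)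

(* Defs.v *)
From HB Require Import structures.
From mathcomp Require Import all_boot all_order all_algebra.
From mathcomp Require Import all_classical all_reals all_analysis.

Set Implicit Arguments.
Unset Strict Implicit.
Unset Printing Implicit Defensive.

Import Order.TTheory GRing.Theory Num.Theory.
Import numFieldNormedType.Exports.

Local Open Scope classical_set_scope.
Local Open Scope ring_scope.

(* A Borel probability [m] on the line is stationary for the iterated function
   system x |-> a x + 1, x |-> b x + 1 with weights (1/2, 1/2). *)
Definition stationary (R : realType) (a b : R)
    (m : probability (measurableTypeR R) R) : Prop :=
  forall A : set (measurableTypeR R), measurable A ->
    m A = ((2^-1)%:E * pushforward m (fun x : R => a * x + 1)%R A
         + (2^-1)%:E * pushforward m (fun x : R => b * x + 1)%R A)%E.

(* Sequences of symbols are encoded as [nat -> bool]: [true] is the symbol 1,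
   [false] is the symbol 2, and [w i] is the symbol i_{i+1}.  The product
   sigma-algebra is the one generated by the coordinates. *)
Definition coord_cylinders : set (set (nat -> bool)) :=
  [set C | exists (i : nat) (b : bool), C = [set w | w i = b]].

Definition Sigma := g_sigma_algebraType coord_cylinders.

(* [nu] is (1/2, 1/2)^N.  The prefix cylinders together with the empty set form
   a pi-system generating the sigma-algebra, so this determines [nu]. *)
Definition bernoulli_half (R : realType) (nu : probability Sigma R) : Prop :=
  forall (n : nat) (u : nat -> bool),
    nu [set w : Sigma | forall i : nat, (i < n)%N -> w i = u i]
      = ((2^-1 : R) ^+ n)%:E.

Definition lam (R : realType) (l1 l2 : R) (s : bool) : R :=
  if s then l1 else l2.

Definition lam_prod (R : realType) (l1 l2 : R) (w : Sigma) (m : nat) : R :=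
  \prod_(i < m) lam l1 l2 (w i).

(* number of symbols 1 among the first [m] *)
Definition occ (w : Sigma) (m : nat) : nat := (\sum_(i < m) w i)%N.

Definition Xsum (R : realType) (l1 l2 : R) (w : Sigma) : R :=
  limn (series (fun m : nat => lam_prod l1 l2 w m)).

(* The sum starts at m = 1, hence the shift of the index. *)
Definition Xder (R : realType) (l1 l2 : R) (j : nat) (w : Sigma) : R :=
  j`!%:R / l1 ^+ j *
  limn (series (fun m : nat =>
    lam_prod l1 l2 w m.+1 * ('C(occ w m.+1, j))%:R)).

Definition phi (R : realType) (t : R) (x : R) : R := x `^ t.

(* [derive1n] is total, so an n-th derivative is meaningful at x only when the
   previous ones are genuine derivatives on a neighbourhood of x; the
   neighbourhood may depend on the order. *)
Definition smooth_at (R : realType) (f : R -> R) (x : R) : Prop :=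
  forall n : nat, \forall y \near x,
    forall k : nat, (k <= n)%N -> derivable (derive1n k f) y 1.

(* In the next three definitions [k j] stands for k_{j+1}, 0 <= j < l; the bound
   k_{j+1} <= l is implied by k_1 + 2 k_2 + ... + l k_l = l. *)
Definition Lcoef (R : realType) (l : nat) (k : {ffun 'I_l -> 'I_l.+1}) : R :=
  l`!%:R / \prod_(j < l) ((k j)`!%:R * (j.+1)`!%:R ^+ k j).

Definition weight (l : nat) (k : {ffun 'I_l -> 'I_l.+1}) : nat :=
  (\sum_(j < l) j.+1 * k j)%N.

Definition formal_derivative (R : realType) (l1 l2 t : R) (l : nat)
    (w : Sigma) : R :=
  \sum_(k : {ffun 'I_l -> 'I_l.+1} | weight k == l)
    Lcoef R k * derive1n (\sum_(j < l) k j)%N (phi t) (Xsum l1 l2 w)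
    * \prod_(j < l) Xder l1 l2 j.+1 w ^+ k j.

(* Main.v *)
Require Import Defs.
From HB Require Import structures.
From mathcomp Require Import all_boot all_order all_algebra.
From mathcomp Require Import all_classical all_reals all_analysis.
From mathcomp Require Import measurable_realfun zify ring lra.
Import Order.TTheory GRing.Theory Num.Theory.
Import numFieldNormedType.Exports.
Local Open Scope classical_set_scope.
Local Open Scope ring_scope.

(* With P_m = lambda_{i_1} ... lambda_{i_m}, the expectation of P_m^t is r^m with
   r = (l1^t + l2^t) / 2 < 1, and r stays below 1 when l1 is replaced by a slightly
   larger L.  Hence almost surely P_m <= K theta^m for all l1 + e <= L, where
   theta < 1 is deterministic and K^t is integrable.

   By Faa di Bruno, each derivative of phi o X is a combination of terms
   X^t prod_j (X^(j) / X)^(k_j).  Although X^(j) / X is unbounded, for every small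
   eta it is at most C (K / X)^eta, so that all these terms are dominated by a
   multiple of K^t, and one may differentiate under the integral sign.

   Finally m = mu_{a,b} is the law of X: iterating the stationarity equation, m is
   the law of S_n + P_n x with x of law m and independent of the symbols, and
   S_n + P_n x tends to X. *)

Set Implicit Arguments.
Unset Strict Implicit.
Unset Printing Implicit Defensive.

(** * Chains of derivatives *)

(** The obstacle is integrability: only [K^t] has a known finite mean. Bounding each X^(j) by a
    multiple of K would leave X^(t-k) K^k, that is X^t (K/X)^k, which K^t does not control once k >
    t and K/X is large. Each factor may therefore cost only a tiny power of K/X; since a term of
    order l has at most l factors, a total exponent at most t is reached by choosing eta in terms of
    l. Since [derive1n] is total, a higher derivative carries no information at a single point.
    Hence chains of functions, each the genuine derivative of the preceding one on an open interval,
    are built for fixed symbols and again after integration; they yield values and smoothness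
    together. The interval is fixed by L alone, before the order of differentiation is chosen. *)

Lemma is_derive_quad (R : realType) (f : R -> R) (z d C r : R) : 0 < r ->
  (forall y, `|y - z| < r -> `|f y - f z - (y - z) * d| <= C * (y - z) ^+ 2) ->
  is_derive z 1 f d.
Proof.
move=> r0 H.
have cv : h^-1 *: (f (h *: 1 + z) - f z) @[h --> 0^'] --> d.
  apply/cvgrPdist_le => e e0.
  near=> h.
  have h0 : h != 0 by near: h; exact: nbhs_dnbhs_neq.
  have hr : `|h| < r by near: h; apply: dnbhs0_lt.
  have he : `|h| * (`|C| + 1) <= e.
    rewrite -ler_pdivlMr ?ltr_wpDl//; near: h; apply: dnbhs0_le.
    by rewrite divr_gt0// ltr_wpDl.
  have /H : `|(h + z) - z| < r by rewrite addrK.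
  rewrite addrK => Hh; rewrite [h *: 1]mulr1.
  rewrite distrC /GRing.scale/= -[X in _ - X](mulKf h0) -mulrBr.
  rewrite normrM normfV ler_pdivrMl ?normr_gt0//.
  apply: (le_trans Hh); rewrite -[h ^+ 2]real_normK ?num_real// expr2 mulrCA.
  rewrite ler_wpM2l//; apply: le_trans he.
  by rewrite mulrC ler_wpM2l// (le_trans (ler_norm _))// lerDl.
apply: DeriveDef; first by apply/cvg_ex; exists d.
exact/cvg_lim.
Unshelve. all: by end_near. Qed.

(** Identifying the next derivative at a point requires equality with [F l] on a neighbourhood,
    hence an open interval as domain. *)
Lemma derive1n_chain (R : realType) (f : R -> R) (F : nat -> R -> R)
    (N : nat) (u v : R) :
  (forall x, u < x < v -> f x = F 0%N x) ->
  (forall l x, (l < N)%N -> u < x < v -> is_derive x 1 (F l) (F l.+1 x)) ->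
  forall l x, (l <= N)%N -> u < x < v -> derive1n l f x = F l x.
Proof.
move=> f0 dF; elim=> [|l IH] x lN ux; first by rewrite derive1n0 f0.
rewrite derive1nS derive1E.
have -> : 'D_1 (derive1n l f) x = 'D_1 (F l) x.
  apply: near_eq_derive; near=> y; apply: IH; first exact: ltnW.
  near: y; have := @near_in_itvoo R u v x; rewrite !in_itv/= => /(_ ux).
  by apply: filterS => y; rewrite in_itv.
by have -> := @derive_val _ _ _ _ _ _ _ (dF l x lN ux).
Unshelve. all: by end_near. Qed.

Lemma derivable_chain (R : realType) (f : R -> R) (F : nat -> R -> R)
    (N : nat) (u v : R) :
  (forall x, u < x < v -> f x = F 0%N x) ->
  (forall l x, (l < N)%N -> u < x < v -> is_derive x 1 (F l) (F l.+1 x)) ->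
  forall l x, (l < N)%N -> u < x < v -> derivable (derive1n l f) x 1.
Proof.
move=> f0 dF l x lN ux; apply: (@near_eq_derivable _ _ _ (F l)); last first.
  by have [] := dF l x lN ux.
near=> y; rewrite (derive1n_chain f0 dF)//; first exact: ltnW.
near: y; have := @near_in_itvoo R u v x; rewrite !in_itv/= => /(_ ux).
by apply: filterS => y; rewrite in_itv.
Unshelve. all: by end_near. Qed.

(** The chain may vary with the target order [N], because a Faa di Bruno expression in [N] variables
    is differentiated correctly only below order [N]. *)
Lemma smooth_at_chain (R : realType) (f : R -> R) (F : nat -> nat -> R -> R)
    (u v x : R) : u < x < v ->
  (forall N y, u < y < v -> f y = F N 0%N y) ->
  (forall N l y, (l < N)%N -> u < y < v ->
    is_derive y 1 (F N l) (F N l.+1 y)) ->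
  smooth_at f x.
Proof.
move=> ux f0 dF n; near=> y => k kn.
apply: (derivable_chain (f0 n.+1) (dF n.+1)) => //.
near: y; have := @near_in_itvoo R u v x; rewrite !in_itv/= => /(_ ux).
by apply: filterS => y; rewrite in_itv.
Unshelve. all: by end_near. Qed.

(* [lim] of a divergent expression is [0]: a jump at [0] makes the difference
   quotient diverge, and otherwise the right quotients vanish. *)
Lemma derive1_right_cst (R : realType) (g : R -> R) (c r : R) : 0 < r ->
  (forall x, 0 < x < r -> g x = c) -> derive1 g 0 = 0.
Proof.
move=> r0 gc; rewrite /derive1.
set q := fun h : R => h^-1 *: (g (h + 0) - g 0).
have [cq|ncq] := pselect (cvg (q h @[h --> 0^'])); last by rewrite dvgP.
set L := lim _.
have cr : q h @[h --> 0^'+] --> L by exact: cvg_dnbhs_at_right.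
have cr2 : (h * q h) @[h --> 0^'+] --> 0 * L.
  by apply: cvgM => //; exact: cvg_at_right_filter.
have cr3 : c - g 0 = 0.
  rewrite mul0r in cr2; apply: cvg_unique cr2 => //.
  apply: cvg_near_cst; near=> h.
  have h0 : 0 < h by near: h; exact: nbhs_right_gt.
  rewrite /q addr0 /GRing.scale/= mulVKf ?gt_eqF// gc// h0/=.
  by near: h; exact: nbhs_right_lt.
apply: cvg_unique cr _ => //.
apply: cvg_near_cst; near=> h.
have h0 : 0 < h by near: h; exact: nbhs_right_gt.
rewrite /q addr0 gc ?cr3 ?scaler0// h0/=.
by near: h; exact: nbhs_right_lt.
Unshelve. all: by end_near. Qed.

(** To the right of 0 every derivative is constant, so the preceding lemma applies to
    [derive1n l g], whatever its value at 0. This settles the symbol sequences for which X diverges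
    at every parameter above [l1]. *)
Lemma derive1n_right_cst (R : realType) (g : R -> R) (c r : R) (l : nat) :
  0 < r -> (forall x, 0 < x < r -> g x = c) -> derive1n l.+1 g 0 = 0.
Proof.
move=> r0 gc.
pose F n (x : R) : R := if n is 0%N then c else 0.
have H k x : 0 < x < r -> derive1n k g x = F k x.
  move=> xr; apply: (@derive1n_chain _ g F k 0 r) => // -[|n] y _ _;
  exact: is_derive_cst.
by rewrite derive1nS; apply: (@derive1_right_cst _ _ (F l 0) r) => // x /H.
Qed.

(** * Differentiation of the random series *)

(** A Taylor remainder without the factor 1/2. The bound is the second derivative of the power at
    [M], so that summation against the coefficients of a series produces its formal derivative of
    order two higher. *)
Lemma exp_quad (R : realFieldType) (y z M : R) (n : nat) :
  0 <= y <= M -> 0 <= z <= M ->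
  `|y ^+ n - z ^+ n - (y - z) * (n%:R * z ^+ n.-1)|
    <= (n * n.-1)%:R * M ^+ (n - 2) * (y - z) ^+ 2.
Proof.
move=> /andP[y0 yM] /andP[z0 zM]; have M0 := le_trans y0 yM.
case: n => [|n]; first by rewrite !expr0 subrr !mul0r mulr0 subrr normr0.
elim: n => [|n IH].
  by rewrite !expr1 expr0 mulr1 mulr1 subrr normr0 muln0 !mul0r.
have -> : y ^+ n.+2 - z ^+ n.+2 - (y - z) * (n.+2%:R * z ^+ n.+2.-1) =
  y * (y ^+ n.+1 - z ^+ n.+1 - (y - z) * (n.+1%:R * z ^+ n.+1.-1))
  + n.+1%:R * z ^+ n * (y - z) ^+ 2.
  by rewrite /= !exprS -!natr1; ring.
apply: (le_trans (ler_normD _ _)).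
have D0 : 0 <= (y - z) ^+ 2 by rewrite sqr_ge0.
rewrite normrM (ger0_norm y0) (ger0_norm (mulr_ge0 (mulr_ge0 _ (exprn_ge0 _ z0)) D0))//.
apply: (@le_trans _ _ ((n.+1 * n)%:R * M ^+ n * (y - z) ^+ 2 +
    n.+1%:R * M ^+ n * (y - z) ^+ 2)).
  apply: lerD; last first.
    by rewrite ler_wpM2r// ler_wpM2l// lerXn2r.
  apply: (@le_trans _ _ (M * ((n.+1 * n)%:R * M ^+ (n.+1 - 2) * (y - z) ^+ 2))).
    refine (ler_pM _ _ _ _); [by []|by []|by []|exact: IH].
  rewrite [_ * M ^+ _]mulrC -!mulrA mulrA.
  case: n {IH} => [|n]; first by rewrite muln0 !(mul0r, mulr0).
  by rewrite -exprS !subSS subn0 mulrCA.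
rewrite -!mulrDl -natrD !subSS subn0 ler_wpM2r// ler_wpM2r ?exprn_ge0//.
rewrite ler_nat.
nia.
Qed.

(** One term of the binomial expansion of [B = z + (B - z)] to the power [n]. The constant is
    independent of [n], so convergence at [B] implies convergence of all formal derivatives at
    [z]. *)
Lemma ffact_exp_le (R : realFieldType) (n j : nat) (z B : R) : 0 <= z < B ->
  (n ^_ j)%:R * z ^+ (n - j) <= j`!%:R / (B - z) ^+ j * B ^+ n.
Proof.
move=> /andP[z0 zB]; have Bz : 0 < B - z by rewrite subr_gt0.
rewrite -mulrA [_^-1 * _]mulrC mulrA ler_pdivlMr ?exprn_gt0//.
rewrite -bin_ffact natrM -!mulrA [X in X <= _]mulrCA ler_wpM2l//.
have -> : B ^+ n = \sum_(i < n.+1) (z ^+ (n - i) * (B - z) ^+ i) *+ 'C(n, i).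
  by rewrite -exprDn addrC subrK.
have s0 (P : pred 'I_n.+1) :
    0 <= \sum_(i < n.+1 | P i) (z ^+ (n - i) * (B - z) ^+ i) *+ 'C(n, i).
  by rewrite sumr_ge0// => i _; rewrite mulrn_wge0// mulr_ge0// exprn_ge0// ltW.
have [jn|nj] := leqP j n; last by rewrite bin_small// mul0r s0.
have jn' : (j < n.+1)%N by [].
by rewrite (bigD1 (Ordinal jn'))//= mulr_natl lerDl s0.
Qed.

(* [dser c n j] is the [j]-th formal derivative of [z |-> \sum_m c_m z^(n_m)].
   For [c_m = l2^(m - o(m))] and [n_m = o(m)] this is [X^(j)] at [z = l1 + e]. *)
Definition dser (R : realType) (c : nat -> R) (n : nat -> nat) (j : nat)
    (z : R) : R :=
  limn (series (fun m => c m * ((n m ^_ j)%:R * z ^+ (n m - j)))).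

Section power_like_series.
Variables (R : realType) (c : nat -> R) (n : nat -> nat) (B : R).
Hypothesis c0 : forall m, 0 <= c m.
Hypothesis cB : cvgn (series (fun m => c m * B ^+ n m)).

Let dterm j z m := c m * ((n m ^_ j)%:R * z ^+ (n m - j)).

Let dterm_ge0 j z m : 0 <= z -> 0 <= dterm j z m.
Proof. by move=> z0; rewrite mulr_ge0// mulr_ge0// exprn_ge0. Qed.

Lemma is_cvg_dser j z : 0 <= z < B ->
  cvgn (series (fun m => c m * ((n m ^_ j)%:R * z ^+ (n m - j)))).
Proof.
move=> zB; have /andP[z0 zB'] := zB; have B0 := le_lt_trans z0 zB'.
have k0 : 0 <= j`!%:R / (B - z) ^+ j by rewrite divr_ge0// exprn_ge0// subr_ge0 ltW.
apply: (@series_le_cvg _ _ ((j`!%:R / (B - z) ^+ j) *: (fun m => c m * B ^+ n m))).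
- by move=> m; exact: dterm_ge0.
- by move=> m; rewrite mulr_ge0// mulr_ge0// exprn_ge0// ltW.
- move=> m; rewrite [X in _ <= X]mulrCA ler_wpM2l//.
  exact: ffact_exp_le.
exact: is_cvg_seriesZ.
Qed.

Lemma is_derive_dser j z : 0 < z < B ->
  is_derive z 1 (dser c n j) (dser c n j.+1 z).
Proof.
move=> /andP[z0 zB].
(* A point between [z] and [B]: the series of order [j.+2] still converges there, and it dominates
   the second-order remainder for all [y] in the chosen neighbourhood, which stays inside ]0, M[. *)
pose M := (z + B) / 2.
have zM : z < M by rewrite midf_lt.
have MB : M < B by rewrite midf_lt.
have M0 : 0 < M := lt_trans z0 zM.
apply: (@is_derive_quad _ _ z _ (dser c n j.+2 M) (Num.min z (M - z))).
  by rewrite lt_min z0 subr_gt0.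
move=> y; rewrite lt_min !ltr_distl => /andP[/andP[y0 _] /andP[_ yM]].
rewrite subrr in y0; rewrite [z + _]addrC subrK in yM.
have cy : cvgn (series (dterm j y)) by apply: is_cvg_dser; rewrite ltW//= (lt_trans yM).
have cz : cvgn (series (dterm j z)) by apply: is_cvg_dser; rewrite ltW.
have cz1 : cvgn (series (dterm j.+1 z)) by apply: is_cvg_dser; rewrite ltW.
have cM : cvgn (series (dterm j.+2 M)) by apply: is_cvg_dser; rewrite ltW.
pose rem := dterm j y - dterm j z - (y - z) *: dterm j.+1 z.
have crem : cvgn (series rem).
  by apply: is_cvg_seriesB; [exact: is_cvg_seriesB|exact: is_cvg_seriesZ].
have -> : dser c n j y - dser c n j z - (y - z) * dser c n j.+1 z
    = limn (series rem).
  rewrite lim_seriesB; [|exact: is_cvg_seriesB|exact: is_cvg_seriesZ].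
  by rewrite lim_seriesB// lim_seriesZ.
have le_rem m : `|rem m| <= (y - z) ^+ 2 * dterm j.+2 M m.
  rewrite /rem /dterm !fctE.
  have -> : c m * ((n m ^_ j)%:R * y ^+ (n m - j)) -
      c m * ((n m ^_ j)%:R * z ^+ (n m - j)) -
      (y - z) *: (c m * ((n m ^_ j.+1)%:R * z ^+ (n m - j.+1))) =
    c m * (n m ^_ j)%:R * (y ^+ (n m - j) - z ^+ (n m - j) -
      (y - z) * ((n m - j)%:R * z ^+ (n m - j).-1)).
    by rewrite ffactnSr natrM -subnS /GRing.scale/=; ring.
  rewrite normrM ger0_norm ?mulr_ge0//.
  apply: le_trans (ler_wpM2l _ (@exp_quad _ y z M (n m - j) _ _)) _.
  - by rewrite mulr_ge0.
  - by rewrite (ltW y0) ltW.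
  - by rewrite (ltW z0) ltW.
  - rewrite !ffactnSr !natrM -subnDA addn2 -subnS le_eqVlt; apply/orP; left.
    by apply/eqP; ring.
have cR : cvgn (series ((y - z) ^+ 2 *: dterm j.+2 M)) by exact: is_cvg_seriesZ.
have nR : cvgn [normed series rem].
  apply: (series_le_cvg _ _ le_rem cR) => m; first exact: normr_ge0.
  by rewrite mulr_ge0 ?sqr_ge0// dterm_ge0// ltW.
apply: (le_trans (lim_series_norm nR)).
apply: (le_trans (lim_series_le nR cR le_rem)).
by rewrite lim_seriesZ// mulrC.
Qed.

End power_like_series.

(** * Faa di Bruno's formula *)

(* The order [l] is decoupled from the number [N >= l] of variables, so that all
   orders up to [N] share one index type. *)
Definition bell (R : realType) (N l : nat) (x y : nat -> R) : R :=
  \sum_(k : {ffun 'I_N -> 'I_N.+1} | weight k == l)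
    l`!%:R / (\prod_(j < N) ((k j)`!%:R * (j.+1)`!%:R ^+ k j))
    * y (\sum_(j < N) k j)%N * \prod_(j < N) x j.+1 ^+ k j.

Lemma leq_weight N (k : {ffun 'I_N -> 'I_N.+1}) (j : 'I_N) :
  (j.+1 * k j <= weight k)%N.
Proof. by rewrite /weight (bigD1 j)//= leq_addr. Qed.

Lemma sum_leq_weight N (k : {ffun 'I_N -> 'I_N.+1}) :
  (\sum_(j < N) k j <= weight k)%N.
Proof. by apply: leq_sum => j _; rewrite leq_pmull. Qed.

Lemma bell0 (R : realType) N (x y : nat -> R) : bell N 0 x y = y 0%N.
Proof.
rewrite /bell (big_pred1 [ffun => ord0]) => [|k] /=; last first.
  apply/eqP/eqP => [w0|->].
    apply/ffunP => j; apply/val_inj; rewrite ffunE /=; apply/eqP.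
    by have := leq_weight k j; rewrite w0 leqn0 muln_eq0.
  by rewrite /weight big1// => j _; rewrite ffunE muln0.
rewrite !big1 => [|j _|j _|j _]; rewrite ?ffunE ?expr0 ?fact0 ?mul1r//.
by rewrite invr1 mulr1 mul1r.
Qed.

Section bell_recurrence.
Variables (R : realType) (N : nat) (x : nat -> R).

Let mono (y : nat -> R) (k : {ffun 'I_N -> 'I_N.+1}) : R :=
  (\prod_(j < N) ((k j)`!%:R * (j.+1)`!%:R ^+ k j))^-1
    * y (\sum_(j < N) k j)%N * \prod_(j < N) x j.+1 ^+ k j.

Let bellE l y :
  bell N l x y = l`!%:R * \sum_(k : {ffun 'I_N -> 'I_N.+1} | weight k == l) mono y k.
Proof. by rewrite /bell mulr_sumr; apply: eq_bigr => k _; rewrite /mono !mulrA. Qed.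

Let incr (j : 'I_N) (k : {ffun 'I_N -> 'I_N.+1}) : {ffun 'I_N -> 'I_N.+1} :=
  [ffun i => inord (k i + (i == j))].
Let decr (j : 'I_N) (k : {ffun 'I_N -> 'I_N.+1}) : {ffun 'I_N -> 'I_N.+1} :=
  [ffun i => inord (k i - (i == j))].

Let incrE j k i : (weight k < N)%N -> incr j k i = (k i + (i == j))%N :> nat.
Proof.
move=> wk; rewrite ffunE inordK//.
case: eqVneq => [->|_]; last by rewrite addn0.
by rewrite addn1 ltnS (leq_ltn_trans _ wk)// (leq_trans _ (leq_weight k j))// leq_pmull.
Qed.

Let decrE j k i : decr j k i = (k i - (i == j))%N :> nat.
Proof. by rewrite ffunE inordK// (leq_ltn_trans (leq_subr _ _)). Qed.

Let weight_incr j k : (weight k < N)%N -> weight (incr j k) = (weight k + j.+1)%N.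
Proof.
move=> wk; rewrite /weight (eq_bigr (fun i : 'I_N => i.+1 * k i + i.+1 * (i == j)))%N.
  rewrite big_split /=; congr addn; rewrite (bigD1 j)//= eqxx muln1 big1 ?addn0//.
  by move=> i /negPf->; rewrite muln0.
by move=> i _; rewrite incrE// mulnDr.
Qed.

(** The new exponent cancels one factor of its factorial, and [j.+1] reduces the additional
    [(j.+1)!] to [j!]. The index of [y] shifts because the monomial gains one factor. *)
Let mono_incr y (j : 'I_N) k : (weight k < N)%N ->
  (j.+1 * incr j k j)%:R * mono y (incr j k)
    = x j.+1 / j`!%:R * mono (fun i => y i.+1) k.
Proof.
move=> wk; rewrite /mono.
have -> : (\sum_(i < N) incr j k i = (\sum_(i < N) k i).+1)%N.
  rewrite (eq_bigr (fun i : 'I_N => k i + (i == j)))%N => [|i _]; last exact: incrE.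
  rewrite big_split /= [X in (_ + X)%N](bigD1 j)//= eqxx [X in (_ + (_ + X))%N]big1 ?addn0 ?addn1//.
  by move=> i /negPf->.
rewrite !(bigD1 j (P := xpredT))//=.
rewrite incrE// eqxx addn1.
have -> : \prod_(i < N | i != j) ((incr j k i)`!%:R * i.+1`!%:R ^+ incr j k i)
    = \prod_(i < N | i != j) ((k i)`!%:R * i.+1`!%:R ^+ k i) :> R.
  by apply: eq_bigr => i /negPf ij; rewrite incrE// ij addn0.
have -> : \prod_(i < N | i != j) x i.+1 ^+ incr j k i
    = \prod_(i < N | i != j) x i.+1 ^+ k i :> R.
  by apply: eq_bigr => i /negPf ij; rewrite incrE// ij addn0.
set P := \prod_(i < N | _) (_ * _).
have P0 : P != 0.
  apply/prodf_neq0 => i _; rewrite mulf_neq0 ?expf_neq0// pnatr_eq0 -lt0n fact_gt0//.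
rewrite !exprS !factS !natrM.
set a := (val (k j))`!%:R; have a0 : a != 0 by rewrite pnatr_eq0 -lt0n fact_gt0.
set b := (val j)`!%:R; have b0 : b != 0 by rewrite pnatr_eq0 -lt0n fact_gt0.
have c0 : (nat_of_ord j).+1%:R != 0 :> R by rewrite pnatr_eq0.
have d0 : (nat_of_ord (k j)).+1%:R != 0 :> R by rewrite pnatr_eq0.
set p := y _; set q := \prod_(i < N | _) _.
have e0 : (j.+1%:R * b) ^+ k j != 0 by rewrite expf_neq0// mulf_neq0.
by field; rewrite e0 a0 b0 P0 !nat1r c0 d0.
Qed.

(** Monomials with exponent 0 at [j] vanish; the others arise by raising that exponent. Position [j]
    stands for the variable of index j + 1, so the weight drops from l + 1 to l - j. *)
Let sum_incr y (j : 'I_N) l : (j <= l)%N -> (l < N)%N ->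
  \sum_(k : {ffun 'I_N -> 'I_N.+1} | weight k == l.+1) (j.+1 * k j)%:R * mono y k
  = x j.+1 / j`!%:R *
    \sum_(k : {ffun 'I_N -> 'I_N.+1} | weight k == (l - j)%N)
      mono (fun i => y i.+1) k.
Proof.
move=> jl lN.
rewrite (bigID (fun k : {ffun 'I_N -> 'I_N.+1} => k j == 0 :> nat))/= big1 ?add0r; last first.
  by move=> k /andP[_ /eqP->]; rewrite muln0 mul0r.
rewrite mulr_sumr (reindex_onto (incr j) (decr j)) /=.
  have wN k : weight k = (l - j)%N -> (weight k < N)%N.
    by move=> ->; rewrite (leq_ltn_trans (leq_subr _ _)).
  have incrK k : (weight k < N)%N -> decr j (incr j k) = k.
    move=> wk; apply/ffunP => i; apply/val_inj.
    by rewrite /= decrE incrE// addnK.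
  rewrite (eq_bigl (fun k : {ffun 'I_N -> 'I_N.+1} => weight k == (l - j)%N)).
    by apply: eq_bigr => k /eqP wk; rewrite mono_incr// wN.
  move=> k; apply/idP/idP => [/andP[/andP[wk kj0] /eqP dk]|/eqP wk].
    (* The bound on [weight k] required by [incrE] is not yet available; the values of [incr j k]
       are recovered from [decr j (incr j k) = k] instead. *)
    have wk' : weight (incr j k) = (weight k + j.+1)%N.
      rewrite /weight (eq_bigr (fun i : 'I_N => i.+1 * k i + i.+1 * (i == j)))%N.
        rewrite big_split /=; congr addn; rewrite (bigD1 j)//= eqxx muln1 big1 ?addn0//.
        by move=> i /negPf->; rewrite muln0.
      move=> i _; rewrite -mulnDr; congr muln.
      rewrite -[in RHS]dk decrE subnK//; case: eqVneq => [->|//].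
      by rewrite lt0n.
    by move: wk; rewrite wk'; lia.
  rewrite weight_incr ?wN// wk incrK ?wN// eqxx andbT incrE ?wN// eqxx addn1 andbT.
  by apply/eqP; lia.
move=> k /andP[wk kj0]; apply/ffunP => i; apply/val_inj; rewrite /=.
have le : ((i == j) <= k i)%N by case: eqVneq => [->|//]; rewrite lt0n.
by rewrite ffunE decrE subnK// inordK.
Qed.

(* Write [l + 1] as the weight [\sum_j j k_j] of each monomial and lower the
   exponent [k_j] in the [j]-th summand. *)
Lemma bellS y l : (l < N)%N ->
  bell N l.+1 x y =
  \sum_(i < l.+1) 'C(l, i)%:R * x i.+1 * bell N (l - i) x (fun k => y k.+1).
Proof.
move=> lN; rewrite bellE factS mulnC natrM -mulrA mulr_sumr.
rewrite (eq_bigr (fun k : {ffun 'I_N -> 'I_N.+1} =>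
    \sum_(j < N) (j.+1 * k j)%:R * mono y k)); last first.
  by move=> k /eqP <-; rewrite /weight natr_sum mulr_suml.
rewrite exchange_big /= mulr_sumr.
have lN1 : (l.+1 <= N)%N by [].
rewrite (big_ord_widen N (fun i => 'C(l, i)%:R * x i.+1 *
    bell N (l - i) x (fun k => y k.+1)) lN1) [in RHS]big_mkcond /=.
apply: eq_bigr => j _; case: ifPn => jl; last first.
  rewrite big1 ?mulr0// => k /eqP wk.
  have := leq_weight k j; rewrite wk => jk.
  suff -> : (k j = 0 :> nat) by rewrite muln0 mul0r.
  by move: jl jk; rewrite -leqNgt; case: (nat_of_ord (k j)) => // n; nia.
rewrite ltnS in jl; rewrite sum_incr// bellE !mulrA; congr (_ * _).
rewrite -(bin_fact jl) !natrM; have : j`!%:R != 0 :> R by rewrite pnatr_eq0 -lt0n fact_gt0.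
by move=> j0; field.
Qed.

End bell_recurrence.

Lemma is_derive_fsum (R : realType) (n : nat) (h : 'I_n -> R -> R)
    (dh : 'I_n -> R) (z : R) :
  (forall i, is_derive z 1 (h i) (dh i)) ->
  is_derive z 1 (fun e => \sum_(i < n) h i e) (\sum_(i < n) dh i).
Proof.
move=> H; have -> : (fun e => \sum_(i < n) h i e) = \sum_(i < n) h i.
  by apply/funext => e; rewrite fct_sumE.
exact: is_derive_sum.
Qed.

(** Here [x 0] is the inner function, which [bell] never reads, and [y k] is the k-th outer
    derivative composed with it; whence the chain rule in the hypothesis on [y]. The recurrence
    [bellS] reduces the claim to the product rule and Pascal's identity; it shifts [y], so the
    induction is over all [y]. *)
Lemma is_derive_bell (R : realType) (N l : nat) (x y : nat -> R -> R) (e : R) :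
  (forall j, is_derive e 1 (x j) (x j.+1 e)) ->
  (forall k, is_derive e 1 (y k) (y k.+1 e * x 1%N e)) -> (l < N)%N ->
  is_derive e 1 (fun e' => bell N l (x^~ e') (y^~ e'))
    (bell N l.+1 (x^~ e) (y^~ e)).
Proof.
move=> dx; elim/ltn_ind: l y => l IH y dy lN.
rewrite bellS//; case: l IH lN => [|l] IH lN.
  rewrite big_ord1 bin0 mul1r bell0 mulrC.
  by under eq_fun do rewrite bell0; exact: dy.
have -> : (fun e' => bell N l.+1 (x^~ e') (y^~ e')) = (fun e' =>
    \sum_(i < l.+1) 'C(l, i)%:R * x i.+1 e' *
      bell N (l - i) (x^~ e') (fun k => y k.+1 e')).
  by apply/funext => e'; rewrite bellS// ltnW.
pose b m := bell N m (x^~ e) (fun k => y k.+1 e).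
have db (i : 'I_l.+1) : is_derive e 1 (fun e' =>
      'C(l, i)%:R * x i.+1 e' * bell N (l - i) (x^~ e') (fun k => y k.+1 e'))
    ('C(l, i)%:R * (x i.+2 e * b (l - i)%N + x i.+1 e * b (l.+1 - i)%N)).
  have il : (i <= l)%N by rewrite -ltnS.
  have li : (l - i < l.+1)%N by lia.
  have liN : (l - i < N)%N by lia.
  have dBi := IH _ li (fun k => y k.+1) (fun k => dy k.+1) liN.
  rewrite -subSn// in dBi.
  have dZ : is_derive e 1 ('C(l, i)%:R *: x i.+1) ('C(l, i)%:R *: x i.+2 e).
    exact: is_deriveZ.
  have dM := is_deriveM dZ dBi.
  apply: (is_derive_eq dM).
  by rewrite /b /GRing.scale/= /GRing.scale/=; ring.
apply: is_derive_eq; first exact: (is_derive_fsum db).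
rewrite (eq_bigr (fun i : 'I_l.+1 => 'C(l, i)%:R * x i.+2 e * b (l - i)%N +
   'C(l, i)%:R * x i.+1 e * b (l.+1 - i)%N)); last first.
  by move=> i _; rewrite mulrDr !mulrA.
rewrite big_split /= [RHS]big_ord_recl /= bin0.
rewrite [X in _ = _ + X](eq_bigr (fun i : 'I_l.+1 =>
    'C(l, i.+1)%:R * x i.+2 e * b (l - i)%N + 'C(l, i)%:R * x i.+2 e * b (l - i)%N)).
  rewrite big_split /= addrA addrC; congr (_ + _).
  (* This is the half of Pascal's identity that needs an index shift; the extra term at [l.+1] is
     zero because its binomial coefficient is. *)
  pose F i := 'C(l, i)%:R * x i.+1 e * b (l.+1 - i)%N.
  have : \sum_(i < l.+2) F i = F 0%N + \sum_(i < l.+1) F i.+1.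
    by rewrite big_ord_recl.
  have F0 : F l.+1 = 0 by rewrite /F bin_small// !mul0r.
  rewrite big_ord_recr /= F0 addr0 => ->.
  by rewrite /F bin0.
by move=> i _; rewrite /bump /= add1n subSS binS natrD !mulrDl.
Qed.

(** * Derivatives of the power function *)

Definition powRd (R : realType) (t : R) (k : nat) (x : R) : R :=
  (\prod_(i < k) (t - i%:R)) * x `^ (t - k%:R).

Lemma is_derive_powRd (R : realType) (t : R) k (x : R) : 0 < x ->
  is_derive x 1 (powRd t k) (powRd t k.+1 x).
Proof.
move=> x0.
have -> : powRd t k = (\prod_(i < k) (t - i%:R)) *: (fun x => x `^ (t - k%:R)).
  by [].
apply: is_derive_eq; first exact/is_deriveZ/is_derive1_powR.
by rewrite /powRd big_ord_recr/= /GRing.scale/= -natr1 opprD addrA mulrA.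
Qed.

Lemma derive1n_powR (R : realType) (t : R) k (x : R) : 0 < x ->
  derive1n k (phi t) x = powRd t k x.
Proof.
move=> x0; apply: (@derive1n_chain _ (phi t) (powRd t) k 0 (x + 1)) => //.
- by move=> y _; rewrite /powRd /phi big_ord0 mul1r subr0.
- by move=> l y _ /andP[y0 _]; exact: is_derive_powRd.
- by rewrite x0 /= ltrDl ltr01.
Qed.

(** * Bounds on the derivatives *)

(** A monomial with k factors combines X^(t-k) with X^k, leaving X^t; and rho^k is at most rho^l
    because k is at most the weight and [1 <= rho]. The constant does not depend on [X], [rho] or
    [x], which makes the bound uniform in the symbols. *)
Lemma bell_le (R : realType) (N l : nat) (t : R) (c : nat -> R) :
  (forall j, 0 <= c j) ->
  exists2 C : R, 0 <= C & forall (X rho : R) (x : nat -> R), 0 < X -> 1 <= rho ->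
    (forall j, 0 <= x j.+1 <= c j.+1 * (X * rho)) ->
    `|bell N l x (fun k => powRd t k X)| <= C * (X `^ t * rho ^+ l).
Proof.
move=> c0.
pose L (k : {ffun 'I_N -> 'I_N.+1}) : R :=
  `|l`!%:R / (\prod_(j < N) ((k j)`!%:R * (j.+1)`!%:R ^+ k j)) *
    \prod_(i < \sum_(j < N) k j) (t - i%:R)| * \prod_(j < N) c j.+1 ^+ k j.
have L0 k : 0 <= L k.
  by rewrite mulr_ge0// prodr_ge0// => j _; rewrite exprn_ge0.
exists (\sum_(k : {ffun 'I_N -> 'I_N.+1} | weight k == l) L k).
  by rewrite sumr_ge0.
move=> X rho x X0 rho1 hx; rewrite mulr_suml.
apply: (le_trans (ler_norm_sum _ _ _)); apply: ler_sum => k /eqP wk.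
have rho0 : 0 <= rho by rewrite (le_trans _ rho1).
rewrite /powRd [_ / _ * (_ * _)]mulrA -[X in `|X|]mulrA normrM /L -[X in _ <= X]mulrA.
rewrite ler_wpM2l//.
rewrite normrM ger0_norm ?powR_ge0// ger0_norm; last first.
  by rewrite prodr_ge0// => j _; rewrite exprn_ge0//; have /andP[] := hx j.
apply: (@le_trans _ _ (X `^ (t - (\sum_(j < N) k j)%:R) *
    \prod_(j < N) (c j.+1 * (X * rho)) ^+ k j)).
  rewrite ler_wpM2l ?powR_ge0// ler_prod// => j _.
  have /andP[x0 xc] := hx j.
  by rewrite exprn_ge0//= lerXn2r// nnegrE// mulr_ge0// mulr_ge0// ltW.
have -> : \prod_(j < N) (c j.+1 * (X * rho)) ^+ k j =
    \prod_(j < N) c j.+1 ^+ k j * (X * rho) ^+ (\sum_(j < N) k j).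
  rewrite -prodrXr -big_split /=; apply: eq_bigr => j _.
  by rewrite exprMn.
rewrite mulrCA ler_wpM2l//.
  by rewrite prodr_ge0// => j _; rewrite exprn_ge0.
rewrite exprMn mulrA -(powR_mulrn _ (ltW X0)) -powRD; last by rewrite (gt_eqF X0) /= implybT.
rewrite subrK ler_wpM2l ?powR_ge0// ler_weXn2l// -wk.
exact: sum_leq_weight.
Qed.

Lemma le_lim_series (R : realType) (u : nat -> R) m :
  (forall m, 0 <= u m) -> cvgn (series u) -> u m <= limn (series u).
Proof.
move=> u0 cu; apply: le_trans (nondecreasing_cvgn_le _ cu m.+1).
  by rewrite seriesSr lerDr sumr_ge0.
by apply/nondecreasing_seqP => n; rewrite seriesSr lerDl.
Qed.

Lemma lim_series_ge0 (R : realType) (u : nat -> R) :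
  (forall m, 0 <= u m) -> 0 <= limn (series u).
Proof.
move=> u0; have [cu|ncu] := pselect (cvgn (series u)); last by rewrite dvgP.
by apply: limr_ge => //; apply: nearW => m; exact: sumr_ge0.
Qed.

Lemma leq_ffact2l n m j : (n <= m)%N -> (n ^_ j <= m ^_ j)%N.
Proof. by move=> nm; rewrite -!bin_ffact leq_mul// leq_bin2l. Qed.

Lemma powR_lt1 (R : realType) (x r : R) : 0 <= x < 1 -> 0 < r -> x `^ r < 1.
Proof.
move=> /andP[x0 x1] r0; have : x `^ r < 1 `^ r.
  by apply: gt0_ltr_powR; rewrite ?nnegrE.
by rewrite powR1.
Qed.

Lemma is_cvg_series_geometric_le (R : realType) (u : nat -> R) (K theta : R) :
  0 <= theta < 1 -> (forall m, 0 <= u m <= K * theta ^+ m) ->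
  cvgn (series u).
Proof.
move=> /andP[t0 t1] h.
apply: (@series_le_cvg _ _ (geometric K theta)).
- by move=> m; have /andP[] := h m.
- by move=> m; have /andP[u0 uK] := h m; rewrite (le_trans u0).
- by move=> m; have /andP[] := h m.
- by apply: is_cvg_geometric_series; rewrite ger0_norm.
Qed.

Lemma lim_series_geometric_le (R : realType) (u : nat -> R) (K theta : R) :
  0 <= theta < 1 -> (forall m, 0 <= u m <= K * theta ^+ m) ->
  limn (series u) <= K / (1 - theta).
Proof.
move=> t01 h; have /andP[t0 t1] := t01.
have t1' : `|theta| < 1 by rewrite ger0_norm.
rewrite -(cvg_lim _ (@cvg_geometric_series _ K _ t1'))//.
apply: lim_series_le.
- exact: is_cvg_series_geometric_le t01 h.
- exact: is_cvg_geometric_series.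
- by move=> m; have /andP[] := h m.
Qed.

(* Each term is at most the whole sum, so it may be replaced by the geometric
   mean of the sum and of its exponential bound; the exponent [eta] given to the
   latter is arbitrarily small and yet absorbs the polynomial factor. *)
Lemma dser_interpolation (R : realType) (z0 theta eta : R) (j : nat) :
  0 < z0 -> 0 < theta < 1 -> 0 < eta <= 1 ->
  exists2 C : R, 0 <= C & forall (c : nat -> R) (n : nat -> nat) (z K : R),
    (forall m, 0 <= c m) -> (forall m, (n m <= m)%N) -> z0 <= z -> 0 <= K ->
    (forall m, c m * z ^+ n m <= K * theta ^+ m) ->
    dser c n j z <= C * (dser c n 0 z `^ (1 - eta) * K `^ eta).
Proof.
move=> z0_gt0 /andP[t0 t1] /andP[e0 e1].
pose q := theta `^ eta.
have q0 : 0 < q by rewrite powR_gt0.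
have q1 : q < 1 by rewrite powR_lt1// ltW.
(* The midpoint of [q] and 1 serves as a radius of convergence strictly beyond [q] for the
   derivatives of the geometric series. *)
have qB : 0 <= q < (q + 1) / 2 by rewrite ltW//= midf_lt.
have cB : cvgn (series (fun m : nat => 1 * ((q + 1) / 2) ^+ m)).
  apply: is_cvg_geometric_series; rewrite ger0_norm ?midf_lt//.
  by have /andP[q0' /ltW] := qB; exact: le_trans.
have c1 (m : nat) : 0 <= (fun=> 1 : R) m by [].
have cs := @is_cvg_dser _ _ id _ c1 cB j _ qB.
(* The first factor bounds the [z ^- j] created by differentiation; the second is the j-th
   derivative of the geometric series at [q], which sums the polynomial factor. *)
exists (z0 ^- j * dser (fun=> 1) id j q).
  rewrite mulr_ge0 ?invr_ge0 ?exprn_ge0// ?(ltW z0_gt0)//.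
  apply: lim_series_ge0 => i.
  by rewrite mulr_ge0// mulr_ge0// exprn_ge0// ltW.
move=> c n z K c0 nm zz K0 h.
have zp : 0 < z := lt_le_trans z0_gt0 zz.
have d0_ge0 m : 0 <= c m * ((n m ^_ 0)%:R * z ^+ (n m - 0)).
  by rewrite mulr_ge0// mulr_ge0// exprn_ge0// ltW.
have cd0 : cvgn (series (fun m => c m * ((n m ^_ 0)%:R * z ^+ (n m - 0)))).
  apply: (@is_cvg_series_geometric_le _ _ K theta); rewrite ?ltW//= => m.
  by rewrite d0_ge0/= ffactn0 mul1r subn0.
pose A := z0 ^- j * (dser c n 0 z `^ (1 - eta) * K `^ eta).
have A0 : 0 <= A.
  by rewrite mulr_ge0 ?mulr_ge0 ?powR_ge0// invr_ge0 exprn_ge0// ltW.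
have term_le m : c m * ((n m ^_ j)%:R * z ^+ (n m - j))
    <= A * (1 * ((m ^_ j)%:R * q ^+ (m - j))).
  rewrite mul1r.
  have [jn|nj] := leqP j (n m); last first.
    by rewrite ffact_small// mul0r mulr0 mulr_ge0// mulr_ge0// exprn_ge0// ltW.
  have P0 : 0 <= c m * z ^+ n m by rewrite mulr_ge0// exprn_ge0// ltW.
  have PX : c m * z ^+ n m <= dser c n 0 z.
    have := le_lim_series m d0_ge0 cd0.
    by rewrite ffactn0 mul1r subn0.
  have P_le : c m * z ^+ n m <= dser c n 0 z `^ (1 - eta) * K `^ eta * q ^+ m.
    rewrite -[X in X <= _](powRr1 P0) -[X in _ `^ X](subrK eta 1).
    rewrite powRD; last by rewrite subrK oner_eq0.
    rewrite -mulrA ler_pM ?powR_ge0//.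
      by apply: ge0_ler_powR; rewrite ?subr_ge0 ?nnegrE// (le_trans P0).
    rewrite /q -(powR_mulrn _ (powR_ge0 _ _)) powRAC (powR_mulrn _ (ltW t0)).
    rewrite -powRM ?exprn_ge0 ?(ltW t0)//.
    have Kt0 : 0 <= K * theta ^+ m by rewrite mulr_ge0// exprn_ge0// ltW.
    by apply: ge0_ler_powR; rewrite ?nnegrE ?(ltW e0).
  have -> : z ^+ (n m - j) = z ^- j * z ^+ n m.
    by rewrite -[in RHS](subnKC jn) exprD mulKf// expf_neq0// gt_eqF.
  rewrite mulrCA [_ * (z ^- j * _)]mulrCA [X in X <= _]mulrCA.
  rewrite /A -mulrA ler_pM//.
  - by rewrite invr_ge0 exprn_ge0// ltW.
  - by rewrite mulr_ge0.
  - by rewrite lef_pV2 ?posrE ?exprn_gt0// lerXn2r// nnegrE ltW.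
  rewrite [X in _ <= X]mulrCA ler_pM// ?ler_nat ?leq_ffact2l//.
  apply: (le_trans P_le); rewrite ler_wpM2l ?mulr_ge0 ?powR_ge0//.
  by rewrite ler_wiXn2l ?ltW// leq_subr.
have cj : cvgn (series (fun m => c m * ((n m ^_ j)%:R * z ^+ (n m - j)))).
  apply: (series_le_cvg _ _ term_le); last exact: is_cvg_seriesZ.
  - by move=> m; rewrite mulr_ge0// mulr_ge0// exprn_ge0// ltW.
  - by move=> m; rewrite mulr_ge0// mulr_ge0// mulr_ge0// exprn_ge0// ltW.
have := lim_series_le cj (is_cvg_seriesZ (k := A) cs) term_le.
by rewrite lim_seriesZ// => /le_trans; apply; rewrite /A /GRing.scale/= mulrAC.
Qed.

Lemma dser0_bounds (R : realType) (c : nat -> R) (n : nat -> nat) (z K theta : R) :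
  (forall m, 0 <= c m) -> n 0%N = 0%N -> c 0%N = 1 -> 0 < z ->
  0 < theta < 1 -> (forall m, c m * z ^+ n m <= K * theta ^+ m) ->
  1 <= dser c n 0 z <= K / (1 - theta).
Proof.
move=> c0 n0 c01 z0 /andP[t0 t1] h.
have h' m : 0 <= c m * ((n m ^_ 0)%:R * z ^+ (n m - 0)) <= K * theta ^+ m.
  rewrite ffactn0 mul1r subn0 h andbT.
  by rewrite mulr_ge0// exprn_ge0// ltW.
have t01 : 0 <= theta < 1 by rewrite ltW.
rewrite (lim_series_geometric_le t01 h') andbT.
have := @le_lim_series _ _ 0 (fun m => proj1 (andP (h' m)))
  (is_cvg_series_geometric_le t01 h').
by rewrite n0 ffactn0 mul1r subn0 c01 expr0 mulr1.
Qed.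

(** The constant is chosen before [c], [n], [z] and [K]; thus one multiple of [K^t] serves all
    admissible symbol sequences and all parameters above [z0]. *)
Lemma bell_dominated (R : realType) (t z0 theta : R) (N l : nat) :
  0 < t -> 0 < z0 -> 0 < theta < 1 ->
  exists2 C : R, 0 <= C & forall (c : nat -> R) (n : nat -> nat) (z K : R),
    (forall m, 0 <= c m) -> (forall m, (n m <= m)%N) -> c 0%N = 1 -> z0 <= z ->
    (forall m, c m * z ^+ n m <= K * theta ^+ m) ->
    `|bell N l (fun j => dser c n j z) (fun k => powRd t k (dser c n 0 z))|
      <= C * K `^ t.
Proof.
move=> t_gt0 z0_gt0 t01; have /andP[theta0 theta1] := t01.
(* Small enough that [l] factors cost at most the exponent [t]; dividing by [l.+1] includes the case
   [l = 0]. *)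
pose eta := Num.min 1 (t / l.+1%:R).
have eta0 : 0 < eta by rewrite lt_min ltr01 divr_gt0.
have eta1 : eta <= 1 by rewrite ge_min lexx.
have etal : eta * l%:R <= t.
  apply: (@le_trans _ _ (t / l.+1%:R * l.+1%:R)); last by rewrite divfK.
  by rewrite ler_pM ?(ltW eta0) ?ler_nat// ge_min lexx orbT.
have eta01 : 0 < eta <= 1 by rewrite eta0.
have /choice[d hd] : forall j, exists C : R, 0 <= C /\
    forall (c : nat -> R) (n : nat -> nat) (z K : R),
    (forall m, 0 <= c m) -> (forall m, (n m <= m)%N) -> z0 <= z -> 0 <= K ->
    (forall m, c m * z ^+ n m <= K * theta ^+ m) ->
    dser c n j z <= C * (dser c n 0 z `^ (1 - eta) * K `^ eta).
  by move=> j; have [C C0 HC] := dser_interpolation j z0_gt0 t01 eta01; exists C.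
have [C C0 HC] := @bell_le R N l t d (fun j => (hd j).1).
exists (C * (1 - theta)^-1 `^ t); first by rewrite mulr_ge0// powR_ge0.
move=> c n z K c0 nm c01 zz h.
have n0 : n 0%N = 0%N by apply/eqP; rewrite -leqn0.
have z_gt0 : 0 < z := lt_le_trans z0_gt0 zz.
have /andP[X1 XK] := dser0_bounds c0 n0 c01 z_gt0 t01 h.
have K1 : 1 <= K by have := h 0%N; rewrite n0 c01 !expr0 !mulr1.
have K0 : 0 <= K := le_trans ler01 K1.
set X := dser c n 0 z in X1 XK *.
have X0 : 0 < X := lt_le_trans ltr01 X1.
have i0 : 0 <= (1 - theta)^-1 by rewrite invr_ge0 subr_ge0 ltW.
(* The ratio K/X enlarged by the geometric sum so as to be at least 1: powers of [Q] then increase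
   with the exponent, and [X * Q] is a constant multiple of [K]. *)
pose Q := K / (1 - theta) / X.
have Q1 : 1 <= Q by rewrite ler_pdivlMr// mul1r.
have Q0 : 0 < Q := lt_le_trans ltr01 Q1.
have rho1 : 1 <= Q `^ eta.
  by rewrite -(powRr0 Q) ler_powR// ltW.
have XQ : X `^ (1 - eta) * K `^ eta <= X * Q `^ eta.
  have XQE : X * Q = K / (1 - theta) by rewrite mulrC divfK ?gt_eqF.
  apply: (@le_trans _ _ (X `^ (1 - eta) * (X * Q) `^ eta)).
    rewrite ler_wpM2l ?powR_ge0//; apply: ge0_ler_powR; rewrite ?nnegrE ?(ltW eta0)//.
      by rewrite mulr_ge0 ?(ltW X0) ?(ltW Q0).
    rewrite XQE ler_peMr// invf_ge1 ?subr_gt0//.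
    by rewrite gerBl ltW.
  rewrite powRM ?(ltW X0) ?(ltW Q0)// mulrA -powRD ?subrK ?powRr1 ?(ltW X0)//.
  by rewrite (gt_eqF X0) /= implybT.
apply: le_trans (HC X (Q `^ eta) _ X0 rho1 _) _.
  move=> j; have [d0 dH] := hd j.+1; apply/andP; split.
    apply: lim_series_ge0 => m.
    by rewrite mulr_ge0// mulr_ge0// exprn_ge0// ltW.
  by apply: le_trans (dH _ _ _ _ c0 nm zz K0 h) _; rewrite ler_wpM2l.
rewrite -mulrA ler_wpM2l//.
apply: (@le_trans _ _ (X `^ t * Q `^ t)).
  rewrite ler_wpM2l ?powR_ge0// -powR_mulrn ?powR_ge0// -powRrM.
  by rewrite ler_powR.
rewrite -powRM ?(ltW X0) ?(ltW Q0)//.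
have -> : X * Q = (1 - theta)^-1 * K by rewrite mulrC divfK ?gt_eqF// mulrC.
by rewrite powRM.
Qed.

(** * The Bernoulli measure *)

(** Such functions are automatically measurable, and their integrals are finite sums over cylinders;
    this replaces product measures and Fubini in the use of independence. *)
Definition depends_on_first (T : Type) (n : nat) (F : Sigma -> T) : Prop :=
  forall w w' : Sigma, (forall i, (i < n)%N -> w i = w' i) -> F w = F w'.

Definition cylinder (n : nat) (u : nat -> bool) : set Sigma :=
  [set w : Sigma | forall i : nat, (i < n)%N -> w i = u i].

Definition of_bits (n : nat) (u : n.-tuple bool) : Sigma := nth false u.

Definition first_bits (n : nat) (w : Sigma) : n.-tuple bool :=
  [tuple w i | i < n].

Lemma of_bitsK n (w : Sigma) i : (i < n)%N -> of_bits (first_bits n w) i = w i.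
Proof. by move=> li; rewrite /of_bits (nth_mktuple _ _ (Ordinal li)). Qed.

Lemma measurable_coord i b : measurable [set w : Sigma | w i = b].
Proof. by apply: sub_sigma_algebra; exists i, b. Qed.

Lemma measurable_cylinder n u : measurable (cylinder n u).
Proof.
rewrite (_ : cylinder n u = \bigcap_(i in `I_n) [set w : Sigma | w i = u i]) //.
by apply: fin_bigcap_measurable => // i _; exact: measurable_coord.
Qed.

Lemma measurable_depends d (T : measurableType d) n (F : Sigma -> T) :
  depends_on_first n F -> measurable_fun setT F.
Proof.
move=> dF _ Y mY; rewrite setTI.
have -> : F @^-1` Y = \bigcup_(u in [set u : n.-tuple bool | Y (F (of_bits u))])
    cylinder n (of_bits u).
  apply/seteqP; split => w /=.
    move=> Fw; exists (first_bits n w) => /=.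
      by rewrite (dF _ w)// => i; exact: of_bitsK.
    by move=> i li; rewrite of_bitsK.
  by move=> [u /= Yu wu]; rewrite (dF _ (of_bits u)).
by apply: fin_bigcup_measurable => // u _; exact: measurable_cylinder.
Qed.

Section bernoulli.
Variables (R : realType) (nu : probability Sigma R).
Hypothesis hnu : bernoulli_half nu.
Local Open Scope ereal_scope.

Lemma nu_cylinder n u : nu (cylinder n u) = ((2^-1 : R) ^+ n)%:E.
Proof. exact: hnu. Qed.

Lemma integral_depends n (D : set Sigma) (F : Sigma -> \bar R) :
  measurable D -> depends_on_first n F -> (forall w, 0 <= F w) ->
  \int[nu]_(w in D) F w =
  \sum_(u : n.-tuple bool) F (of_bits u) * nu (D `&` cylinder n (of_bits u)).
Proof.
move=> mD dF F0.
have DE : D = \big[setU/set0]_(u <- enum {: n.-tuple bool}) (D `&` cylinder n (of_bits u)).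
  rewrite -bigcup_seq; apply/seteqP; split => w /=.
    move=> Dw; exists (first_bits n w); first by rewrite /= mem_enum.
    by split=> // i li; rewrite of_bitsK.
  by move=> [u _ []].
rewrite [X in integral _ X]DE ge0_integral_bigsetU/=; first last.
- by [].
- by apply: measurable_funTS; exact: measurable_depends dF.
- move=> u v _ _ [w [[_ wu] [_ wv]]]; apply/eq_from_tnth => i.
  by rewrite !(tnth_nth false) -[LHS]wu// -[RHS]wv.
- exact: enum_uniq.
- by move=> u; apply: measurableI => //; exact: measurable_cylinder.
rewrite big_enum; apply: eq_bigr => u _.
rewrite -integral_cst; last by apply: measurableI => //; exact: measurable_cylinder.
by apply: eq_integral => w; rewrite inE => -[_ wu]; exact: dF.
Qed.

(** Independence of a symbol from its predecessors: fixing it cuts a cylinder of length [n] down to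
    one of length [n.+1], of half the measure. *)
Lemma integral_coord n b (F : Sigma -> \bar R) :
  depends_on_first n F -> (forall w, 0 <= F w) ->
  \int[nu]_(w in [set w : Sigma | w n = b]) F w = (2^-1)%:E * \int[nu]_w F w.
Proof.
move=> dF F0; rewrite !(integral_depends _ dF)//; last exact: measurable_coord.
rewrite ge0_sume_distrr; last by move=> u _; rewrite mule_ge0.
apply: eq_bigr => u _; rewrite setTI muleCA; congr (_ * _).
rewrite nu_cylinder -EFinM -exprS -(nu_cylinder n.+1 (fun i => if i == n then b else of_bits u i)).
congr (nu _); apply/seteqP; split => w /=.
  move=> [wn wu] i; rewrite ltnS leq_eqVlt; case: eqVneq => [->//|_]/=.
  exact: wu.
move=> h; split; first by rewrite h// eqxx.
by move=> i li; rewrite h ?ltn_eqF// ltnS ltnW.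
Qed.

Lemma integral_step n (F : bool -> Sigma -> \bar R) :
  (forall b, depends_on_first n (F b)) -> (forall b w, 0 <= F b w) ->
  \int[nu]_w F (w n) w =
  (2^-1)%:E * \int[nu]_w F true w + (2^-1)%:E * \int[nu]_w F false w.
Proof.
move=> dF F0.
have mE b := measurable_coord n b.
have setTE : [set: Sigma] = [set w : Sigma | w n = true] `|` [set w : Sigma | w n = false].
  by apply/seteqP; split => // w _ /=; case: (w n); [left|right].
rewrite [in LHS]setTE ge0_integral_setU//; first last.
- by apply/disj_setPS => w /= [->].
- apply: measurable_funTS; apply: (@measurable_depends _ _ n.+1) => w w' ww'.
  rewrite ww'//; apply: dF => i li; apply: ww'; exact: ltnW.
rewrite -(integral_coord true (dF true))// -(integral_coord false (dF false))//.
by congr (_ + _); apply: eq_integral => w; rewrite inE /= => ->.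
Qed.

Lemma integral_prod (a : bool -> R) n : (forall b, 0 <= a b)%R ->
  \int[nu]_w (\prod_(i < n) a (w i))%:E = (((a true + a false) / 2) ^+ n)%:E.
Proof.
move=> a0.
have dP m : depends_on_first m (fun w : Sigma => \prod_(i < m) a (w i))%R.
  by move=> w w' ww'; apply: eq_bigr => i _; rewrite ww'.
elim: n => [|n IH].
  under eq_integral do rewrite big_ord0.
  by rewrite integral_cst// mul1e expr0; exact: probability_setT.
under eq_integral do rewrite big_ord_recr.
have P0 w : (0 <= \prod_(i < n) a (w i))%R by rewrite prodr_ge0.
rewrite (integral_step (n := n) (F := fun b w => (\prod_(i < n) a (w i) * a b)%:E)); first last.
- by move=> b w; rewrite lee_fin mulr_ge0.
- by move=> b w w' ww'; rewrite (dP n w w' ww').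
have E b : \int[nu]_w (\prod_(i < n) a (w i) * a b)%:E =
    (((a true + a false) / 2) ^+ n * a b)%:E.
  under eq_integral do rewrite EFinM muleC.
  have mP : measurable_fun [set: Sigma] (fun w => (\prod_(i < n) a (w i))%:E).
    by apply: (@measurable_depends _ _ n) => w w' ww'; rewrite (dP n w w' ww').
  rewrite (ge0_integralZl nu measurableT mP); last by rewrite lee_fin.
    by rewrite IH -EFinM mulrC.
  by move=> w _; rewrite lee_fin.
by rewrite !E -!EFinM -EFinD exprS; congr (_%:E); ring.
Qed.

End bernoulli.

Definition prefix_sum (R : realType) (a b : R) (n : nat) (w : Sigma) : R :=
  series (fun m => lam_prod a b w m) n.

(** * The stationary measure is the law of X *)

(* The composition f_{i_1} o ... o f_{i_n} of the maps of the system. *)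
Definition prefix_map (R : realType) (a b : R) (n : nat) (w : Sigma)
    (x : measurableTypeR R) : measurableTypeR R :=
  prefix_sum a b n w + lam_prod a b w n * x.

Section iterate.
Variables (R : realType) (a b : R).

Lemma lam_prodS (w : Sigma) n :
  lam_prod a b w n.+1 = lam_prod a b w n * lam a b (w n).
Proof. by rewrite /lam_prod big_ord_recr. Qed.

Lemma prefix_sumS n w : prefix_sum a b n.+1 w = prefix_sum a b n w + lam_prod a b w n.
Proof. by rewrite /prefix_sum seriesSr. Qed.

Lemma lam_prod_depends n : depends_on_first n (fun w => lam_prod a b w n).
Proof. by move=> w w' ww'; apply: eq_bigr => i _; rewrite ww'. Qed.

Lemma prefix_sum_depends n : depends_on_first n (prefix_sum a b n).
Proof.
move=> w w' ww'; rewrite /prefix_sum /series/= !big_mkord; apply: eq_bigr => i _.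
by apply: (@lam_prod_depends i) => j ji; rewrite ww'// (ltn_trans ji).
Qed.

Lemma measurable_lam_prod n : measurable_fun setT (fun w => lam_prod a b w n).
Proof. exact: measurable_depends (@lam_prod_depends n). Qed.

Lemma prefix_map_depends n : depends_on_first n (prefix_map a b n).
Proof.
move=> w w' ww'; apply/funext => x.
by rewrite /prefix_map (prefix_sum_depends ww') (lam_prod_depends ww').
Qed.

Lemma measurable_preimage_prefix_map n w (A : set (measurableTypeR R)) :
  measurable A -> measurable (prefix_map a b n w @^-1` A).
Proof.
have mp : measurable_fun setT (prefix_map a b n w).
  apply: measurable_funD; first exact: measurable_cst.
  by apply: measurable_funM; [exact: measurable_cst|exact: measurable_id].
by move=> mA; rewrite -[_ @^-1` _]setTI; exact: mp.
Qed.

Local Open Scope ereal_scope.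
Variables (nu : probability Sigma R) (m : probability (measurableTypeR R) R).
Hypotheses (hnu : bernoulli_half nu) (hm : stationary a b m).

Lemma stationary_iterate n (A : set (measurableTypeR R)) : measurable A ->
  m A = \int[nu]_w m (prefix_map a b n w @^-1` A).
Proof.
move=> mA; have dm k : depends_on_first k (fun w => m (prefix_map a b k w @^-1` A)).
  by move=> w w' ww'; rewrite (prefix_map_depends ww').
elim: n => [|n ->].
  rewrite (eq_integral (cst (m A))); last first.
    move=> w _; congr (m _); apply/seteqP; split => x /=;
    by rewrite /prefix_map /prefix_sum /series/= big_geq// /lam_prod big_ord0 mul1r add0r.
  have nu1 : nu [set: Sigma] = 1 := probability_setT nu.
  by rewrite integral_cst// -[LHS]mule1; congr (_ * _); exact: esym nu1.
pose B w := prefix_map a b n w @^-1` A.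
have mB w : measurable (B w).
  exact: measurable_preimage_prefix_map.
pose F (s : bool) w := pushforward m (fun x : R => lam a b s * x + 1)%R (B w).
have -> : \int[nu]_w m (prefix_map a b n.+1 w @^-1` A) = \int[nu]_w F (w n) w.
  apply: eq_integral => w _; rewrite /F /pushforward; congr (m _).
  (* The newest map acts innermost, so stationarity applies to the preimage [B w], which depends
     only on the first [n] symbols. *)
  have E x : prefix_map a b n.+1 w x = prefix_map a b n w (lam a b (w n) * x + 1)%R.
    by rewrite /prefix_map prefix_sumS lam_prodS; ring.
  by apply/seteqP; split => x; rewrite /preimage/= /B/= E.
have dF s : depends_on_first n (F s).
  by move=> w w' ww'; rewrite /F /B (prefix_map_depends ww').
have F0 s w : 0 <= F s w by rewrite /F /pushforward measure_ge0.
rewrite (integral_step hnu dF)//.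
have mF s : measurable_fun setT (F s) := measurable_depends (dF s).
rewrite -!ge0_integralZl//; [|by rewrite lee_fin..].
have mh s : measurable_fun setT (fun w => (2^-1)%:E * F s w) by exact: measurable_funeM.
have h0 s w : setT w -> 0 <= (2^-1)%:E * F s w by move=> _; rewrite mule_ge0.
rewrite -(ge0_integralD nu measurableT (h0 true) (mh true) (h0 false) (mh false)).
by apply: eq_integral => w _; exact: (hm (mB w)).
Qed.

End iterate.

Lemma limn_einf_le (R : realType) (u : nat -> \bar R) (c : \bar R) :
  (forall n, u n <= c)%E -> (limn_einf u <= c)%E.
Proof.
move=> uc; rewrite limn_einf_lim; apply: lime_le; first exact: is_cvg_einfs.
apply: nearW => n; apply: le_trans (uc n).
by apply: ereal_inf_lbound; exists n => /=.
Qed.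

Lemma limn_einf_ge (R : realType) (u : nat -> \bar R) (c : \bar R) :
  (\forall n \near \oo, c <= u n)%E -> (c <= limn_einf u)%E.
Proof.
move=> [N _ cu]; rewrite limn_einf_lim; apply: lime_ge; first exact: is_cvg_einfs.
exists N => // n /= Nn; apply: le_ereal_inf_tmp => _ [k /= nk <-].
exact/cu/(leq_trans Nn).
Qed.

Lemma measurable_fun_limn_einf d (T : measurableType d) (R : realType)
    (D : set T) (f : nat -> T -> \bar R) :
  (forall n, measurable_fun D (f n)) ->
  measurable_fun D (fun x => limn_einf (f ^~ x)).
Proof.
move=> mf; apply: (emeasurable_fun_cvg (fun n x => einfs (f ^~ x) n)).
  by move=> n; exact: measurable_fun_einfs.
by move=> x _; rewrite limn_einf_lim; exact: is_cvg_einfs.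
Qed.

Section law.
Variables (R : realType) (a b : R).
Local Open Scope ereal_scope.
Variables (nu : probability Sigma R) (m : probability (measurableTypeR R) R).
Hypotheses (hnu : bernoulli_half nu) (hm : stationary a b m).
Variables (D : set Sigma) (Y : Sigma -> measurableTypeR R).
Hypotheses (mD : measurable D) (nuD : nu D = 1) (mY : measurable_fun setT Y)
  (cvY : forall w, D w -> series (fun n => lam_prod a b w n) @ \oo --> (Y w : R)).

Let mYA A : measurable A -> measurable (Y @^-1` A).
Proof. by move=> mA; rewrite -[_ @^-1` _]setTI; exact: mY. Qed.

Let nuID A : measurable A -> nu (A `&` D) = nu A.
Proof.
move=> mA; have nuDC : nu (~` D) = 0 by rewrite probability_setC// nuD subee.
apply/eqP; rewrite eq_le; apply/andP; split.
  by apply: le_measure; rewrite ?inE//; exact: measurableI.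
have mAD : measurable (A `&` D) by exact: measurableI.
have mDC : measurable (~` D) by exact: measurableC.
rewrite -[X in _ <= X]adde0 -nuDC -measureU//.
  apply: le_measure; rewrite ?inE//; first exact: measurableU.
  by move=> w Aw; have [Dw|nDw] := pselect (D w); [left|right].
by apply/seteqP; split => w // [[]].
Qed.

(* [m] is the mean of the laws of [S_n + P_n x], which converges to [Y]; Fatou's
   lemma is applied to [m] and then to [nu]. *)
Lemma law_open_le (A : set (measurableTypeR R)) : measurable A -> open (A : set R) ->
  nu (Y @^-1` A) <= m A.
Proof.
move=> mA oA.
have morb n w := measurable_preimage_prefix_map a b n w mA.
pose J n w := m (prefix_map a b n w @^-1` A).
have dJ k : depends_on_first k (J k).
  by move=> w w' ww'; rewrite /J (prefix_map_depends (n := k) a b ww').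
have mJ n : measurable_fun setT (J n) := measurable_depends (dJ n).
have J0 n w : 0 <= J n w by exact: measure_ge0.
rewrite -(nuID (mYA mA)) -(integral_indic nu mD (mYA mA)).
apply: (@le_trans _ _ (\int[nu]_(w in D) limn_einf (J^~ w))).
  apply: ge0_le_integral => //.
  - by apply/measurable_EFinP/measurable_indic; exact: mYA.
  - by apply: measurable_fun_limn_einf => n; exact: measurable_funTS.
  move=> w Dw; have [YA|nYA] := pselect (A (Y w)); last first.
    by rewrite indicE memNset//; apply: limn_einf_ge; exact: nearW.
  rewrite indicE mem_set//.
  pose g n (x : measurableTypeR R) : \bar R := (\1_(prefix_map a b n w @^-1` A) x)%:E.
  have -> : J^~ w = (fun n => \int[m]_x g n x).
    by apply/funext => n; rewrite /g integral_indic// setIT.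
  have mg n : measurable_fun setT (g n) by apply/measurable_EFinP/measurable_indic.
  apply: le_trans (fatou m measurableT mg _); last by move=> n x _; rewrite lee_fin.
  have m1 : m [set: _] = 1 := probability_setT m.
  rewrite -[X in X <= _]m1 -[X in X <= _]mul1e -integral_cst//.
  apply: ge0_le_integral => //.
  - by apply: measurable_fun_limn_einf.
  move=> x _; apply: limn_einf_ge.
  have cvo : prefix_map a b n w x @[n --> \oo] --> (Y w : R).
    have -> : (Y w = Y w + 0 * x :> R)%R by rewrite mul0r addr0.
    apply: cvgD; first exact: cvY.
    apply: cvgM; last exact: cvg_cst.
    apply: cvg_series_cvg_0; apply/cvg_ex; exists (Y w); exact: cvY.
  have nA : nbhs (Y w : R) A by apply: open_nbhs_nbhs.
  by near=> n; rewrite /g indicE mem_set//; near: n; exact: cvo.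
apply: (le_trans (fatou nu mD _ _)) => //.
  by move=> n; exact: measurable_funTS.
apply: limn_einf_le => n; rewrite (stationary_iterate hnu hm n mA).
exact: ge0_subset_integral.
Unshelve. all: by end_near. Qed.

(** The inequality for open sets suffices: complementing it on ]-oo, c[ reverses it on closed right
    rays, increasing unions extend the reversed one to open right rays, and these form a generating
    pi-system. *)
Lemma law_eq (A : set (measurableTypeR R)) : measurable A -> m A = nu (Y @^-1` A).
Proof.
move=> mA.
have mitv (i : interval R) : measurable ([set` i] : set (measurableTypeR R)).
  exact: measurable_itv.
have cray (c : R) : m `[c, +oo[%classic <= nu (Y @^-1` `[c, +oo[%classic).
  rewrite -[X in m X]setCitvl -[X in Y @^-1` X]setCitvl preimage_setC.
  have -> : m (~` `]-oo, c[%classic) = 1 - m `]-oo, c[%classic.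
    exact: (probability_setC m (mitv _)).
  have -> : nu (~` (Y @^-1` `]-oo, c[%classic)) = 1 - nu (Y @^-1` `]-oo, c[%classic).
    exact: (probability_setC nu (mYA (mitv _))).
  by apply: leeB => //; apply: law_open_le; [exact: mitv|exact: interval_open].
have oray (c : R) : m `]c, +oo[%classic = nu (Y @^-1` `]c, +oo[%classic).
  apply/eqP; rewrite eq_le; apply/andP; split; last first.
    by apply: law_open_le; [exact: mitv|exact: interval_open].
  pose F k : set (measurableTypeR R) := `[(c + k.+1%:R^-1)%R, +oo[%classic.
  have UF : \bigcup_k F k = `]c, +oo[%classic.
    apply/seteqP; split => x; rewrite /F.
      move=> [k _]; rewrite /= !in_itv/= !andbT; apply: lt_le_trans.
      by rewrite ltrDl invr_gt0.
    rewrite /= in_itv/= andbT => /ltr_add_invr[k ck]; exists k => //=.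
    by rewrite in_itv/= andbT ltW.
  have cvF : m (F k) @[k --> \oo] --> m (\bigcup_k F k).
    apply: nondecreasing_cvg_mu; first by move=> k; exact: mitv.
      by rewrite UF; exact: mitv.
    move=> k l kl; apply/subsetPset => x; rewrite /F /= !in_itv/= !andbT.
    by apply: le_trans; rewrite lerD2l lef_pV2 ?posrE// ler_nat.
  rewrite -[X in m X]UF -(cvg_lim _ cvF)//; apply: lime_le; first by apply/cvg_ex; eexists; exact: cvF.
  apply: nearW => k; apply: (le_trans (cray _)).
  apply: le_measure; rewrite ?inE; [by apply: mYA; exact: mitv|by apply: mYA; exact: mitv|].
  by apply: preimage_subset; rewrite -UF => x Fx; exists k.
apply: (@measure_unique _ _ (measurableTypeR R) (@RGenOInfty.G R)
  (fun k => `](- k%:R)%R, +oo[%classic) _ _ _ _ m (pushforward nu Y)) => //.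
- exact: RGenOInfty.measurableE.
- move=> _ _ [x ->] [y ->]; exists (Num.max x y).
  apply/seteqP; split => z /=; rewrite !in_itv/= !andbT gt_max.
    by move=> [-> ->].
  by move=> /andP.
- by move=> i; exists (- i%:R)%R.
- apply/seteqP; split => // x _; exists (Num.truncn `|x|).+1 => //=.
  rewrite in_itv/= andbT ltrNl; apply: le_lt_trans (truncnS_gt _).
  by rewrite -normrN ler_norm.
- by move=> _ [c ->]; exact: oray.
- by move=> k; apply: le_lt_trans (probability_le1 m (mitv _)) _; rewrite ltry.
Qed.

End law.

(** * Measurability in the sequence of symbols *)

(** The second part includes divergence, where [limn] and [fine +oo] are both 0. It transfers
    measurability from extended-valued sums to [limn] without discarding null sets. *)
Lemma nneseries_fine (R : realType) (u : nat -> R) : (forall m, 0 <= u m) ->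
  [/\ cvgn (series u) <-> (\sum_(0 <= m <oo) (u m)%:E < +oo)%E &
      limn (series u) = fine (\sum_(0 <= m <oo) (u m)%:E)%E].
Proof.
move=> u0.
have eE : (fun n => \sum_(0 <= m < n) (u m)%:E)%E = EFin \o series u.
  by apply/funext => n; rewrite /= /series/= sumEFin.
have lt_oo : cvgn (series u) ->
    (\sum_(0 <= m <oo) (u m)%:E)%E = (limn (series u))%:E.
  by move=> cu; rewrite eE EFin_lim.
have cv : (\sum_(0 <= m <oo) (u m)%:E < +oo)%E -> cvgn (series u).
  move=> uoo; apply: nondecreasing_is_cvgn.
    by apply/nondecreasing_seqP => n; rewrite seriesSr lerDl.
  exists (fine (\sum_(0 <= m <oo) (u m)%:E)%E) => _ [n _ <-].
  rewrite -lee_fin fineK; last first.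
    by rewrite ge0_fin_numE// nneseries_ge0// => m _ _; rewrite lee_fin.
  rewrite -[X in (X <= _)%E]/((EFin \o series u) n) -eE.
  by apply: nneseries_lim_ge => m _ _; rewrite lee_fin.
split; first by split=> [cu|//]; rewrite lt_oo// ltry.
have [cu|ncu] := pselect (cvgn (series u)); first by rewrite lt_oo.
rewrite dvgP//; suff -> : (\sum_(0 <= m <oo) (u m)%:E = +oo)%E by [].
by apply/eqP; rewrite -leye_eq leNgt; apply/negP => /cv.
Qed.

Section measurable_nonneg_series.
Context d (T : measurableType d) (R : realType) (u : nat -> T -> R).
Hypotheses (u0 : forall m w, 0 <= u m w) (mu : forall m, measurable_fun setT (u m)).

Let mS : measurable_fun setT (fun w => \sum_(0 <= m <oo) (u m w)%:E)%E.
Proof.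
apply: ge0_emeasurable_sum => [k x _ _|k _]; first by rewrite lee_fin.
exact/measurable_EFinP.
Qed.

Lemma measurable_lim_series : measurable_fun setT (fun w => limn (series (u ^~ w))).
Proof.
rewrite (_ : (fun w => _) = fine \o (fun w => \sum_(0 <= m <oo) (u m w)%:E)%E).
  by apply: measurableT_comp mS; exact: fine_measurable.
by apply/funext => w; have [] := nneseries_fine (u0 ^~ w).
Qed.

Lemma measurable_cvg_series : measurable [set w | cvgn (series (u ^~ w))].
Proof.
rewrite (_ : [set w | _] = [set w | \sum_(0 <= m <oo) (u m w)%:E < +oo]%E).
  by rewrite -[X in measurable X]setTI; exact: emeasurable_fun_infty_o.
by apply/seteqP; split => w /=; have [cE _] := nneseries_fine (u0 ^~ w); apply cE.
Qed.

End measurable_nonneg_series.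

(** * The random series as power series in the first parameter *)

Definition coef (R : realType) (b : R) (w : Sigma) (m : nat) : R :=
  b ^+ (m - occ w m).

Lemma occ_le (w : Sigma) m : (occ w m <= m)%N.
Proof.
by rewrite /occ -[X in (_ <= X)%N]card_ord -sum1_card; apply: leq_sum => i _; case: (w i).
Qed.

Lemma occS (w : Sigma) m : occ w m.+1 = (occ w m + w m)%N.
Proof. by rewrite /occ big_ord_recr. Qed.

Lemma lam_prodE (R : realType) (a b : R) (w : Sigma) m :
  lam_prod a b w m = coef b w m * a ^+ occ w m.
Proof.
rewrite /coef; elim: m => [|m IH].
  by rewrite /lam_prod /occ !big_ord0 !expr0 mulr1.
rewrite lam_prodS IH occS /lam; have := occ_le w m; case: (w m) => h.
  by rewrite addn1 subSS exprSr mulrA.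
by rewrite addn0 subSn// exprSr mulrAC.
Qed.

Lemma coef_ge0 (R : realType) (b : R) w m : 0 <= b -> 0 <= coef b w m.
Proof. exact: exprn_ge0. Qed.

Lemma measurable_occ_depends d (T : measurableType d) (f : nat -> T) m :
  measurable_fun setT (fun w : Sigma => f (occ w m)).
Proof.
apply: (@measurable_depends _ _ m) => w w' ww'; congr (f _).
by apply: eq_bigr => i _; rewrite ww'.
Qed.

Lemma XsumE (R : realType) (a b : R) (w : Sigma) :
  Xsum a b w = dser (coef b w) (occ w) 0 a.
Proof.
rewrite /Xsum /dser; congr (limn (series _)); apply/funext => m.
by rewrite lam_prodE ffactn0 mul1r subn0.
Qed.

(** The term m = 0 vanishes since the order is positive, which reconciles the starting indices.
    Comparing extended sums covers divergent series too: both sides are then 0. *)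
Lemma XderE (R : realType) (a b : R) j (w : Sigma) : 0 < a -> 0 <= b ->
  Xder a b j.+1 w = dser (coef b w) (occ w) j.+1 a.
Proof.
move=> a0 b0; rewrite /Xder /dser.
set v := fun m => coef b w m * _; set u := fun m => lam_prod a b w m.+1 * _.
have v0 m : 0 <= v m.
  by rewrite mulr_ge0 ?coef_ge0// mulr_ge0// exprn_ge0// ltW.
have u0 m : 0 <= u m.
  by rewrite mulr_ge0// lam_prodE mulr_ge0 ?coef_ge0// exprn_ge0// ltW.
have vu m : v m.+1 = j.+1`!%:R / a ^+ j.+1 * u m.
  rewrite /v /u lam_prodE -bin_ffact natrM.
  have [jo|oj] := leqP j.+1 (occ w m.+1).
    rewrite -[in RHS](subnKC jo) exprD.
    have : a ^+ j.+1 != 0 by rewrite expf_neq0// gt_eqF.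
    by move=> aj; rewrite subnKC//; field.
  by rewrite bin_small// !(mulr0, mul0r).
have v00 : v 0%N = 0 by rewrite /v /occ big_ord0 ffact0n mul0r mulr0.
have [_ ->] := nneseries_fine v0; have [_ ->] := nneseries_fine u0.
have v0' k : (0 <= (v k)%:E)%E by rewrite lee_fin.
rewrite [in RHS]nneseries_recl// v00 add0e -(nneseries_addn 1)//.
under [in RHS]eq_eseriesr do rewrite addn1 vu EFinM.
rewrite nneseriesZl; last by move=> k _; rewrite lee_fin.
set S := (\sum_(0 <= m <oo) _)%E.
have k0 : 0 < j.+1`!%:R / a ^+ j.+1 by rewrite divr_gt0// ?exprn_gt0// ltr0n fact_gt0.
have S0 : (0 <= S)%E by apply: nneseries_ge0 => m _ _; rewrite lee_fin.
case: S S0 => [s||] //= _.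
by rewrite gt0_muley ?lte_fin//= mulr0.
Qed.

Lemma measurable_dser (R : realType) (a b : R) j : 0 <= a -> 0 <= b ->
  measurable_fun setT (fun w => dser (coef b w) (occ w) j a).
Proof.
move=> a0 b0; rewrite /dser.
apply: (@measurable_lim_series _ _ _
  (fun m w => coef b w m * ((occ w m ^_ j)%:R * a ^+ (occ w m - j)))).
  by move=> m w; rewrite mulr_ge0 ?coef_ge0// mulr_ge0// exprn_ge0.
by move=> m; exact: (measurable_occ_depends (fun k => b ^+ (m - k) * ((k ^_ j)%:R * a ^+ (k - j)))).
Qed.

(** * An integrable dominating variable *)

(** The arithmetic-geometric mean inequality for [a^t] and [b^t]. *)
Lemma lt1_mul_of_mean_powR (R : realType) (a b t : R) :
  0 < a -> 0 < b -> 0 < t -> (a `^ t + b `^ t) / 2 < 1 -> a * b < 1.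
Proof.
move=> a0 b0 t0 h; rewrite ltNge; apply/negP => ab1.
have : 1 `^ t <= (a * b) `^ t.
  by apply: ge0_ler_powR; rewrite ?nnegrE ?(ltW t0)// mulr_ge0// ltW.
rewrite powR1 /= (powRM _ (ltW a0) (ltW b0)).
move: h (powR_gt0 t a0) (powR_gt0 t b0); set x := a `^ t; set y := b `^ t.
move=> h x0 y0 xy1.
have h1 : 0 < (2 - (x + y)) * (2 + (x + y)) by rewrite mulr_gt0//; lra.
by have := sqr_ge0 (x - y); nra.
Qed.

Lemma mean_powR_gap (R : realType) (a b t : R) : 0 < a -> a < 1 -> 0 < t ->
  (a `^ t + b `^ t) / 2 < 1 ->
  exists2 L, a < L < 1 & (L `^ t + b `^ t) / 2 < 1.
Proof.
move=> a0 a1 t0 h.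
pose s := 2 - b `^ t.
have as_ : a `^ t < s by rewrite /s; lra.
have s0 : 0 < s := lt_trans (powR_gt0 t a0) as_.
have powK x : 0 <= x -> (x `^ t) `^ t^-1 = x.
  by move=> x0; rewrite -powRrM divff ?gt_eqF// powRr1.
have als : a < s `^ t^-1.
  rewrite -[X in X < _](powK a (ltW a0)).
  by apply: gt0_ltr_powR; rewrite ?invr_gt0// ?nnegrE ?powR_ge0// ltW.
(* [s^(1/t)] is where the mean of the t-th powers reaches 1. The minimum with 1 keeps the first map
   contracting for every parameter below [L]. *)
pose M := Num.min 1 (s `^ t^-1).
have aM : a < M by rewrite lt_min a1.
have aL : a < (a + M) / 2 by rewrite midf_lt.
have LM : (a + M) / 2 < M by rewrite midf_lt.
exists ((a + M) / 2).
  by rewrite aL /= (lt_le_trans LM)// ge_min lexx.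
have Ls : ((a + M) / 2) `^ t < s.
  have -> : s = (s `^ t^-1) `^ t by rewrite -powRrM mulVf ?gt_eqF// powRr1// ltW.
  apply: gt0_ltr_powR; rewrite ?nnegrE ?powR_ge0//.
    by rewrite ltW// (lt_trans a0).
  by rewrite (lt_le_trans LM)// ge_min lexx orbT.
by rewrite /s in Ls; lra.
Qed.

Lemma powR_prod (R : realType) n (F : 'I_n -> R) (t : R) :
  (forall i, 0 <= F i) -> (\prod_(i < n) F i) `^ t = \prod_(i < n) F i `^ t.
Proof.
move=> F0; elim: n F F0 => [|n IH] F F0; first by rewrite !big_ord0 powR1.
by rewrite !big_ord_recr/= powRM ?prodr_ge0// IH.
Qed.

Section domination.
Variables (R : realType) (nu : probability Sigma R).
Hypothesis hnu : bernoulli_half nu.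
Variables (L l2 t : R).
Hypotheses (L0 : 0 < L) (l20 : 0 < l2) (t0 : 0 < t)
  (hL : (L `^ t + l2 `^ t) / 2 < 1).

(* With [r < q < 1] for [r := (L^t + l2^t) / 2], the sum
   [g := \sum_m P_m^t q^-m] has the finite mean [\sum_m (r / q)^m], and
   [P_m <= g^(1/t) (q^(1/t))^m] for every [m]. *)
Lemma exponential_domination :
  exists (D : set Sigma) (g : Sigma -> R) (theta : R),
    [/\ measurable D, nu D = 1%E, (forall w, 0 <= g w), 0 < theta < 1 &
       nu.-integrable setT (EFin \o g) /\
       forall w, D w -> exists2 K, K `^ t = g w &
         forall m, lam_prod L l2 w m <= K * theta ^+ m].
Proof.
pose r := (L `^ t + l2 `^ t) / 2.
have r0 : 0 < r by rewrite divr_gt0// addr_gt0// powR_gt0.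
pose q := (r + 1) / 2.
have rq : r < q by rewrite midf_lt.
have q1 : q < 1 by rewrite midf_lt.
have q0 : 0 < q := lt_trans r0 rq.
pose a s := lam L l2 s `^ t / q.
have a0 s : 0 <= a s by rewrite divr_ge0// ?powR_ge0// ltW.
pose u m (w : Sigma) := \prod_(i < m) a (w i).
have u0 m w : 0 <= u m w by rewrite prodr_ge0.
have mu m : measurable_fun setT (u m).
  by apply: (@measurable_depends _ _ m) => w w' ww'; apply: eq_bigr => i _; rewrite ww'.
pose G w := (\sum_(0 <= m <oo) (u m w)%:E)%E.
have G0 w : (0 <= G w)%E by apply: nneseries_ge0 => m _ _; rewrite lee_fin.
have mG : measurable_fun setT G.
  apply: ge0_emeasurable_sum => [k x _ _|k _]; first by rewrite lee_fin.
  exact/measurable_EFinP.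
have rq1 : `|r / q| < 1.
  have rq_ge0 : 0 <= r / q by apply: divr_ge0; exact: ltW.
  by rewrite (ger0_norm rq_ge0) ltr_pdivrMr// mul1r.
have intG : (\int[nu]_w G w < +oo)%E.
  have mEu m : measurable_fun setT (EFin \o u m) by exact/measurable_EFinP.
  have Eu0 m w : setT w -> (0 <= (EFin \o u m) w)%E by rewrite lee_fin.
  rewrite (integral_nneseries nu measurableT mEu Eu0).
  under eq_eseriesr do rewrite /u (integral_prod hnu)//.
  have a20 m : 0 <= ((a true + a false) / 2) ^+ m.
    by rewrite exprn_ge0// divr_ge0// addr_ge0.
  have [cE _] := nneseries_fine a20.
  apply/cE; have -> : (a true + a false) / 2 = r / q by rewrite /a /r /= -mulrDl mulrAC.
  have := @is_cvg_geometric_series _ 1 _ rq1.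
  by rewrite /geometric /=; under eq_fun do rewrite mul1r.
have iG : nu.-integrable setT G.
  apply/integrableP; split => //.
  by under eq_integral do rewrite gee0_abs//.
pose D := [set w | G w < +oo]%E.
have mD : measurable D by rewrite -[D]setTI; exact: emeasurable_fun_infty_o.
have theta0 : 0 < q `^ t^-1 by rewrite powR_gt0.
have theta1 : q `^ t^-1 < 1 by rewrite powR_lt1 ?invr_gt0// ltW.
have nuDC : nu (~` D) = 0%E.
  have [Z [mZ Z0 subZ]] := integrable_ae measurableT iG.
  apply: (@subset_measure0 _ _ _ nu _ Z) => //; first exact: measurableC.
  move=> w nDw; apply: subZ => /= /(_ I) Gfin; apply: nDw.
  by rewrite /D /= -ge0_fin_numE.
have mfG : measurable_fun setT (EFin \o (fine \o G)).
  apply/measurable_EFinP; apply: measurableT_comp mG; exact: fine_measurable.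
(* Outside [D] the sum [G] is infinite and [fine] returns 0: the majorant is real everywhere, while
   the exponential bound is claimed on [D] only. *)
exists D, (fine \o G), (q `^ t^-1); split => //.
- have := probability_setC nu (measurableC mD).
  by rewrite setCK nuDC sube0.
- by move=> w; rewrite /= fine_ge0.
- by rewrite theta0.
split.
  apply: (le_integrable measurableT mfG _ iG) => w _ /=.
  rewrite (gee0_abs (G0 w)) ger0_norm ?fine_ge0//.
  by case: (G w) (G0 w) => //= _; rewrite leey.
move=> w Dw; have Gfin : G w \is a fin_num by rewrite ge0_fin_numE.
exists (fine (G w) `^ t^-1).
  by rewrite -powRrM mulVf ?gt_eqF// powRr1// fine_ge0.
move=> m.
have P0 i : 0 <= lam L l2 (w i) by rewrite /lam; case: ifP => _; rewrite ltW.
have Pt : lam_prod L l2 w m `^ t <= fine (G w) * q ^+ m.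
  have -> : lam_prod L l2 w m `^ t = u m w * q ^+ m.
    rewrite /lam_prod powR_prod// /u -[in q ^+ m](card_ord m) -prodr_const.
    by rewrite -big_split /=; apply: eq_bigr => i _; rewrite /a divfK// gt_eqF.
  rewrite ler_wpM2r ?exprn_ge0 ?(ltW q0)//.
  have [cE <-] := nneseries_fine (u0 ^~ w).
  by apply: (le_lim_series m (u0 ^~ w)); apply/cE.
have Pm0 : 0 <= lam_prod L l2 w m by rewrite prodr_ge0.
rewrite -[X in X <= _](powRr1 Pm0).
rewrite -[X in _ `^ X <= _](mulfV (lt0r_neq0 t0)) powRrM.
have -> : (q `^ t^-1) ^+ m = (q ^+ m) `^ t^-1.
  by rewrite -(powR_mulrn _ (ltW theta0)) powRAC (powR_mulrn _ (ltW q0)).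
rewrite -powRM ?fine_ge0 ?exprn_ge0 ?(ltW q0)//.
apply: ge0_ler_powR; rewrite ?nnegrE ?powR_ge0// ?invr_ge0 ?(ltW t0)//.
by rewrite mulr_ge0 ?fine_ge0// exprn_ge0// ltW.
Qed.

End domination.

(** * Pointwise derivatives of phi o X *)

Definition faa (R : realType) (l2 t : R) (N l : nat) (w : Sigma) (z : R) : R :=
  bell N l (fun j => dser (coef l2 w) (occ w) j z)
    (fun k => powRd t k (dser (coef l2 w) (occ w) 0 z)).

Section pointwise.
Variables (R : realType) (l2 t : R) (w : Sigma).
Hypothesis l2_ge0 : 0 <= l2.

Lemma series_lam_prodE a : series (fun m => lam_prod a l2 w m) =
  series (fun m => coef l2 w m * a ^+ occ w m).
Proof. by congr series; apply/funext => m; rewrite lam_prodE. Qed.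

Lemma lam_prod_ge0 a m : 0 <= a -> 0 <= lam_prod a l2 w m.
Proof. by move=> a0; rewrite lam_prodE mulr_ge0 ?coef_ge0// exprn_ge0. Qed.

Lemma cvg_lam_prodW a L : 0 <= a <= L ->
  cvgn (series (fun m => lam_prod L l2 w m)) ->
  cvgn (series (fun m => lam_prod a l2 w m)).
Proof.
move=> /andP[a0 aL]; have L0 := le_trans a0 aL.
apply: series_le_cvg => m; [exact: lam_prod_ge0|exact: lam_prod_ge0|].
by rewrite !lam_prodE ler_wpM2l ?coef_ge0// lerXn2r.
Qed.

Lemma Xsum_ge1 a : 0 <= a -> cvgn (series (fun m => lam_prod a l2 w m)) ->
  1 <= Xsum a l2 w.
Proof.
move=> a0 ca; have := le_lim_series 0 (fun m => lam_prod_ge0 m a0) ca.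
by rewrite {1}/lam_prod big_ord0.
Qed.

Variable L : R.
Hypothesis cL : cvgn (series (fun m => lam_prod L l2 w m)).

Lemma is_derive_faa N l z : 0 < z < L -> (l < N)%N ->
  is_derive z 1 (faa l2 t N l w) (faa l2 t N l.+1 w z).
Proof.
move=> zL lN; have /andP[z0 zL'] := zL.
have cL' := cL; rewrite series_lam_prodE in cL'.
have dx j : is_derive z 1 (dser (coef l2 w) (occ w) j)
    (dser (coef l2 w) (occ w) j.+1 z).
  by apply: is_derive_dser zL => // m; exact: coef_ge0.
have X0 : 0 < dser (coef l2 w) (occ w) 0 z.
  rewrite -XsumE (lt_le_trans ltr01)// Xsum_ge1// ?(ltW z0)//.
  by apply: cvg_lam_prodW cL; rewrite !ltW.
apply: (is_derive_bell (x := fun j z => dser (coef l2 w) (occ w) j z)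
  (y := fun k z => powRd t k (dser (coef l2 w) (occ w) 0 z))) => // k.
exact: (is_derive1_comp (is_derive_powRd t k X0) (dx 0%N)).
Qed.

Lemma faa0 N a : phi t (Xsum a l2 w) = faa l2 t N 0 w a.
Proof. by rewrite /faa bell0 /powRd big_ord0 mul1r subr0 -XsumE. Qed.

Variable l1 : R.

Lemma is_derive_faa_shift N l e : - l1 < e < L - l1 -> (l < N)%N ->
  is_derive e 1 (fun e => faa l2 t N l w (l1 + e)) (faa l2 t N l.+1 w (l1 + e)).
Proof.
move=> /andP[e1 e2] lN.
have le : 0 < l1 + e < L by apply/andP; split; lra.
have ds : is_derive e 1 (fun e => l1 + e) 1.
  rewrite -[X in is_derive _ _ _ X]add0r.
  exact: (is_deriveD (is_derive_cst l1 e 1) (is_derive_id e 1)).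
rewrite -[X in is_derive _ _ _ X]mulr1.
exact: (is_derive1_comp (is_derive_faa le lN) ds).
Qed.

Lemma derive1n_phiX N l e : - l1 < e < L - l1 -> (l <= N)%N ->
  derive1n l (fun e => phi t (Xsum (l1 + e) l2 w)) e = faa l2 t N l w (l1 + e).
Proof.
move=> he lN.
apply: (derive1n_chain (F := fun l e => faa l2 t N l w (l1 + e)) _ _ lN he).
  by move=> x _; exact: faa0.
by move=> k x kN hx; exact: is_derive_faa_shift.
Qed.

Hypothesis l1L : 0 < l1 < L.

Let I0 : - l1 < 0 < L - l1.
Proof. by have /andP[h1 h2] := l1L; apply/andP; split; lra. Qed.

Lemma smooth_at_phiX : smooth_at (fun e => phi t (Xsum (l1 + e) l2 w)) 0.
Proof.
apply: (smooth_at_chain (F := fun N l e => faa l2 t N l w (l1 + e)) I0).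
  by move=> N x _; exact: faa0.
by move=> N k x kN hx; exact: is_derive_faa_shift.
Qed.

(** Taking as many variables as the order makes the index type of [bell] that of
    [formal_derivative]; X being at least 1 identifies the derivatives of [phi t] with their closed
    form. *)
Lemma derive1n_phiX_formal l :
  derive1n l (fun e => phi t (Xsum (l1 + e) l2 w)) 0 = formal_derivative l1 l2 t l w.
Proof.
have /andP[l1_gt0 l1_lt] := l1L.
rewrite (@derive1n_phiX l)// addr0 /faa /bell /formal_derivative.
apply: eq_bigr => k _; rewrite /Lcoef derive1n_powR ?XsumE; last first.
  rewrite -XsumE (lt_le_trans ltr01)// Xsum_ge1// ?(ltW l1_gt0)//.
  by apply: cvg_lam_prodW cL; rewrite !ltW.
by congr (_ * _); apply: eq_bigr => j _; rewrite XderE.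
Qed.

End pointwise.

Lemma derive1n_phiX_dvg (R : realType) (l1 l2 t : R) (w : Sigma) (l : nat) :
  (forall x, 0 < x -> ~ cvgn (series (fun m => lam_prod (l1 + x) l2 w m))) ->
  derive1n l.+1 (fun e => phi t (Xsum (l1 + e) l2 w)) 0 = 0.
Proof.
move=> h; apply: (@derive1n_right_cst _ _ (phi t 0) 1) => // x /andP[x0 _].
by rewrite /Xsum dvgP//; exact: h.
Qed.

Section measurability.
Variables (R : realType) (l2 t : R).
Hypothesis l2_ge0 : 0 <= l2.

Let measurable_sum_cond d (T : measurableType d) (I : finType) (P : pred I)
    (h : I -> T -> R) : (forall i, measurable_fun setT (h i)) ->
  measurable_fun setT (fun x => \sum_(i | P i) h i x).
Proof.
move=> mh; under eq_fun do rewrite -big_filter.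
exact: measurable_sum.
Qed.

Lemma measurable_powRd k : measurable_fun setT (powRd t k : R -> R).
Proof.
apply: measurable_funM; first exact: measurable_cst.
exact: measurable_powR.
Qed.

Lemma measurable_faa N l z : 0 <= z -> measurable_fun setT (fun w => faa l2 t N l w z).
Proof.
move=> z0; apply: measurable_sum_cond => k.
apply: measurable_funM.
  apply: measurable_funM; first exact: measurable_cst.
  apply: measurableT_comp; first exact: measurable_powRd.
  exact: measurable_dser.
apply: measurable_prod => j _; apply: measurable_funX; exact: measurable_dser.
Qed.

Lemma measurable_Xsum a : 0 <= a -> measurable_fun setT (Xsum a l2).
Proof.
move=> a0; rewrite (_ : Xsum a l2 = fun w => dser (coef l2 w) (occ w) 0 a).
  exact: measurable_dser.
by apply/funext => w; rewrite XsumE.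
Qed.

Lemma Xsum_ge0 a w : 0 <= a -> 0 <= Xsum a l2 w.
Proof. by move=> a0; apply: lim_series_ge0 => m; exact: lam_prod_ge0. Qed.

Lemma measurable_formal_derivative l1 l : 0 < l1 ->
  measurable_fun setT (formal_derivative l1 l2 t l).
Proof.
move=> l1_gt0; apply: measurable_sum_cond => k.
have mX := measurable_Xsum (ltW l1_gt0).
apply: measurable_funM.
  apply: measurable_funM; first exact: measurable_cst.
  set n := (\sum_(j < l) k j)%N.
  (* [Xsum] is never negative, and it is 0 only by the default value at divergence; there the
     derivative of [phi t] is some fixed number, whatever it is. *)
  rewrite (_ : (fun w => _) = (fun w => if 0 < Xsum l1 l2 w
      then powRd t n (Xsum l1 l2 w) else derive1n n (phi t) 0)).
    apply: measurable_fun_ifT; last exact: measurable_cst.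
      by apply: measurable_fun_ltr => //; exact: measurable_cst.
    by apply: measurableT_comp mX; exact: measurable_powRd.
  apply/funext => w; case: ifPn => [X0|]; first exact: derive1n_powR.
  rewrite -leNgt => X0; congr (derive1n _ _ _); apply/eqP.
  by rewrite eq_le X0 Xsum_ge0// ltW.
apply: measurable_prod => j _; apply: measurable_funX.
rewrite (_ : Xder l1 l2 j.+1 = fun w => dser (coef l2 w) (occ w) j.+1 l1).
  by apply: measurable_dser => //; exact: ltW.
by apply/funext => w; rewrite XderE.
Qed.

(* Measurability is needed also on the null set where [X] diverges for all
   [e > 0]; there [Xsum] is the junk constant [0] to the right of [0]. *)
Lemma measurable_derive1n_phiX l1 l : 0 < l1 ->
  measurable_fun setT (fun w => derive1n l.+1 (fun e => phi t (Xsum (l1 + e) l2 w)) 0).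
Proof.
move=> l1_gt0.
(* Convergence at some parameter above [l1] forces it at all smaller ones above [l1], so a countable
   union describes this event. *)
pose E := \bigcup_k [set w : Sigma |
  cvgn (series (fun m => lam_prod (l1 + k.+1%:R^-1) l2 w m))].
have mE : measurable E.
  apply: bigcupT_measurable => k.
  apply: (@measurable_cvg_series _ _ _ (fun m w => lam_prod (l1 + k.+1%:R^-1) l2 w m)).
    by move=> m w; apply: lam_prod_ge0 => //; rewrite addr_ge0// ltW.
  by move=> m; exact: measurable_lam_prod.
rewrite (_ : (fun w => _) = (fun w => if w \in E then formal_derivative l1 l2 t l.+1 w else 0)).
  apply: measurable_fun_ifT; last exact: measurable_cst.
    apply: (measurable_fun_bool true); rewrite setTI.
    rewrite (_ : _ @^-1` _ = E)//; apply/seteqP; split => w /=; first exact: set_mem.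
    exact: mem_set.
  exact: measurable_formal_derivative.
apply/funext => w; case: ifPn => [|/negP nE].
  rewrite inE => -[k _ ck]; apply: (derive1n_phiX_formal t l2_ge0 ck).
  by rewrite l1_gt0 ltrDl invr_gt0/=.
apply: derive1n_phiX_dvg => x x0 cx; apply: nE; rewrite inE.
have [k kx] := ltr_add_invr x0; exists k => //=.
apply: cvg_lam_prodW cx => //; rewrite addr_ge0 ?(ltW l1_gt0)//=.
by rewrite lerD2l ltW// -[X in X < _]add0r.
Qed.

End measurability.

(** * Integration *)

Section full_measure.
Context d (T : measurableType d) (R : realType) (P : probability T R).
Variables (D : set T).
Hypotheses (mD : measurable D) (PD : P D = 1%E).
Local Open Scope ereal_scope.

Lemma full_measureC0 : P (~` D) = 0.
Proof. by rewrite probability_setC// PD subee. Qed.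

Lemma integrable_full (f g : T -> R) : P.-integrable setT (EFin \o g) ->
  (forall x, 0 <= g x)%R -> measurable_fun setT f ->
  (forall x, D x -> `|f x| <= g x)%R -> P.-integrable setT (EFin \o f).
Proof.
move=> ig g0 mf fg; apply/integrableP; split; first exact/measurable_EFinP.
have /integrableP[mg /le_lt_trans] := ig; apply.
have mnf (h : T -> R) : measurable_fun setT (EFin \o h) ->
    measurable_fun setT (fun x => `|(EFin \o h) x|).
  by move=> mh; apply: measurableT_comp mh; exact: abse_measurable.
apply: ae_ge0_le_integral => //.
- exact/mnf/measurable_EFinP.
- exact: mnf.
exists (~` D); split; [exact: measurableC|exact: full_measureC0|].
move=> x nfg Dx; apply: nfg => _ /=.
by rewrite lee_fin (ger0_norm (g0 x)) fg.
Qed.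

Lemma Rintegral_full (f : T -> R) : P.-integrable setT (EFin \o f) ->
  (\int[P]_x f x = \int[P]_(x in D) f x)%R.
Proof.
move=> ifx; rewrite /Rintegral (negligible_integral (measurableC mD))//.
  by rewrite setTD setCK.
exact: full_measureC0.
Qed.

End full_measure.

(** Derivability and domination are demanded at every point of the domain, not almost everywhere;
    hence the integral over the good set [D]. *)
Lemma is_derive_Rintegral (R : realType) d (T : measurableType d)
    (P : probability T R) (D : set T) (f f' : R -> T -> R) (u v a : R) (G : T -> R) :
  measurable D -> u < a < v ->
  (forall x, u < x < v -> P.-integrable D (EFin \o f x)) ->
  (forall x w, u < x < v -> D w -> is_derive x 1 (f ^~ w) (f' x w)) ->
  (forall w, 0 <= G w) -> P.-integrable D (EFin \o G) ->
  (forall x w, u < x < v -> D w -> `|f' x w| <= G w) ->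
  is_derive a 1 (fun x => \int[P]_(w in D) f x w) (\int[P]_(w in D) f' a w).
Proof.
move=> mD ua intf df G0 iG fG.
have I x : (`]u, v[ x)%classic -> u < x < v by rewrite /= in_itv.
have d1 x w : u < x < v -> D w -> partial1of2 f x w = f' x w.
  by move=> ux Dw; rewrite partial1of2E; exact: (@derive_val _ _ _ _ _ _ _ (df x w ux Dw)).
have Ia : (`]u, v[ a)%classic by rewrite /= in_itv.
have := cvg_differentiation_under_integral mD Ia (fun x h => intf x (I x h))
  (fun x w h Dw => @ex_derive _ _ _ _ _ _ _ (df x w (I x h) Dw)) G0 iG _.
move=> /(_ _)/wrap[|cv].
  by move=> x w /I ux Dw; rewrite d1// fG.
have E : \int[P]_(w in D) partial1of2 f a w = \int[P]_(w in D) f' a w.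
  by apply: eq_Rintegral => w; rewrite inE => Dw; rewrite d1.
rewrite E in cv.
set F := fun x => \int[P]_(w in D) f x w.
have cv' : h^-1 *: (F (h *: 1 + a) - F a) @[h --> 0^'] --> \int[P]_(w in D) f' a w.
  rewrite (_ : (fun h => _) = fun h => h^-1 *: (F (h + a) - F a))//.
  by apply/funext => h; rewrite [h *: 1]mulr1.
apply: DeriveDef; first by apply/cvg_ex; eexists; exact: cv'.
exact/cvg_lim.
Qed.

Lemma stationary_moment (R : realType) (a b t : R) (nu : probability Sigma R)
    (m : probability (measurableTypeR R) R) (D : set Sigma) :
  bernoulli_half nu -> stationary a b m -> 0 <= a -> 0 <= b ->
  measurable D -> nu D = 1%E ->
  (forall w, D w -> cvgn (series (fun n => lam_prod a b w n))) ->
  (\int[m]_(x in [set x : R | 1 <= x]%R) (phi t x)%:E =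
   \int[nu]_(w in D) (phi t (Xsum a b w))%:E)%E.
Proof.
move=> hnu hm a0 b0 mD nuD cD.
pose Y : Sigma -> measurableTypeR R := Xsum a b.
have mX : measurable_fun setT Y := measurable_Xsum b0 a0.
have meq A : measurable A -> m A = nu (Y @^-1` A).
  exact: (law_eq hnu hm mD nuD mX cD).
have m1 : measurable ([set x | 1 <= x]%R : set (measurableTypeR R)).
  by rewrite -set_itvcy; exact: measurable_itv.
have mphi : measurable_fun setT (phi t : measurableTypeR R -> measurableTypeR R).
  exact: measurable_powR.
rewrite (eq_measure_integral (pushforward nu Y)); last first.
  by move=> A mA _; exact: meq.
rewrite (ge0_integral_pushforward mX)//; last 2 first.
- by apply: measurable_funTS; exact/measurable_EFinP.
- by move=> x _; rewrite lee_fin powR_ge0.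
have mD1 : measurable (Y @^-1` [set x | 1 <= x]%R).
  by rewrite -[_ @^-1` _]setTI; exact: mX.
(* On [D] the sum X is at least 1, so removing the null complement of [D] from the preimage of [1,
   +oo[ leaves exactly [D]. *)
rewrite (ge0_negligible_integral (measurableC mD) mD1)//.
- rewrite setDE setCK setIidr// => w Dw /=; apply: Xsum_ge1 => //; exact: cD.
- apply: measurable_funTS; apply/measurable_EFinP.
  by apply: (measurableT_comp mphi mX).
- by move=> w _; rewrite lee_fin powR_ge0.
- exact: full_measureC0.
Qed.

Unset Implicit Arguments.
Set Strict Implicit.
Set Printing Implicit Defensive.

Theorem theorem1p2 (R : realType)
    (mu : R -> R -> probability (measurableTypeR R) R)
    (hmu : forall a b : R, 0 < a -> a < 1 -> 1 < b -> a * b < 1 ->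
       stationary a b (mu a b))
    (nu : probability Sigma R) (hnu : bernoulli_half nu)
    (l1 l2 t : R) (l1_gt0 : 0 < l1) (l1_lt1 : l1 < 1) (l2_gt1 : 1 < l2)
    (t_gt0 : 0 < t) (hlt : (l1 `^ t + l2 `^ t) / 2 < 1) :
  let h : R -> R := fun e =>
    \int[mu (l1 + e) l2]_(x in [set x : R | 1 <= x]) phi t x in
  let phiX : Sigma -> R -> R := fun w e => phi t (Xsum (l1 + e) l2 w) in
  [/\ l1 * l2 < 1,
      \forall e \near (0 : R), (mu (l1 + e) l2).-integrable
        [set x : R | 1 <= x] (EFin \o phi t),
      smooth_at h 0,
      {ae nu, forall w : Sigma, smooth_at (phiX w) 0} &
      forall l : nat, (1 <= l)%N ->
        [/\ nu.-integrable setT (fun w => (derive1n l (phiX w) 0)%:E),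
            nu.-integrable setT (fun w => (formal_derivative l1 l2 t l w)%:E),
            derive1n l h 0 = \int[nu]_w (derive1n l (phiX w) 0) &
            \int[nu]_w (derive1n l (phiX w) 0)
              = \int[nu]_w (formal_derivative l1 l2 t l w)]].
Proof.
move=> h phiX.
have l2_gt0 : 0 < l2 := lt_trans ltr01 l2_gt1.
have l2_ge0 := ltW l2_gt0.
have [L /andP[l1L L1] hL] := mean_powR_gap l1_gt0 l1_lt1 t_gt0 hlt.
have L0 : 0 < L := lt_trans l1_gt0 l1L.
have Ll2 : L * l2 < 1 := lt1_mul_of_mean_powR L0 l2_gt0 t_gt0 hL.
have [D [g [theta [mD nuD g0 theta01 [ig dom]]]]] :=
  exponential_domination hnu L0 l2_gt0 t_gt0 hL.
have /andP[theta0 theta1] := theta01.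
have cD w : D w -> cvgn (series (fun m => lam_prod L l2 w m)).
  move=> /dom[K _ hK]; apply: (@is_cvg_series_geometric_le _ _ K theta).
    by rewrite ltW.
  by move=> m; rewrite hK andbT lam_prod_ge0// ltW.
(* The left end keeps [l1 + e] above [l1 / 2], the positive lower bound [z0] asked for by
   [bell_dominated]; the right end keeps it below [L]. *)
pose u := - (l1 / 2); pose v := L - l1.
have u0v : u < 0 < v by apply/andP; rewrite /u /v; split; lra.
have zlt (e : R) : u < e < v -> l1 / 2 <= l1 + e /\ 0 < l1 + e < L.
  by rewrite /u /v => /andP[? ?]; split; [lra|apply/andP; split; lra].
pose F N l e w := faa l2 t N l w (l1 + e).
(* The products increase with the first parameter, so the exponential bound at [L] holds with the
   same [K] for all these [e]; the majorant is therefore independent of [e]. *)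
have Fle N l : exists2 C : R, 0 <= C &
    forall (e : R) w, u < e < v -> D w -> `|F N l e w| <= C * g w.
  have l12 : 0 < l1 / 2 by rewrite divr_gt0.
  have [C C0 HC] := bell_dominated N l t_gt0 l12 theta01.
  exists C => // e w /zlt[zl /andP[z0 zL]] /dom[K <- hK].
  apply: HC => // [m|m|m]; first exact: coef_ge0.
    exact: occ_le.
  apply: le_trans (hK m).
  by rewrite lam_prodE ler_wpM2l ?coef_ge0// lerXn2r ?nnegrE ?ltW.
have iCg C : 0 <= C -> nu.-integrable setT (EFin \o (fun w => C * g w)).
  move=> C0; rewrite (_ : _ \o _ = (fun w => C%:E * (EFin \o g) w)%E).
    exact: integrableZl.
  by apply/funext.
have Cg0 C w : 0 <= C -> 0 <= C * g w by move=> C0; rewrite mulr_ge0.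
have iF N l (e : R) : u < e < v -> nu.-integrable setT (EFin \o F N l e).
  move=> ue; have [C C0 HC] := Fle N l.
  apply: (integrable_full mD nuD (iCg C C0)) => [w||w Dw]; first exact: Cg0.
    by have [_ /andP[z0 _]] := zlt e ue; apply: measurable_faa => //; exact: ltW.
  exact: HC.
have iFD N l (e : R) : u < e < v -> nu.-integrable D (EFin \o F N l e).
  by move=> ue; apply: integrableS (iF N l e ue).
have e_in (e : R) : u < e < v -> - l1 < e < L - l1.
  by rewrite /u /v => /andP[? ?]; apply/andP; split; lra.
have dF N l (e : R) w : u < e < v -> D w -> (l < N)%N ->
    is_derive e 1 (fun e => F N l e w) (F N l.+1 e w).
  by move=> ue Dw lN; apply: (is_derive_faa_shift t l2_ge0 (cD w Dw)) => //; exact: e_in.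
pose H N l e := \int[nu]_(w in D) F N l e w.
have dH N l (e : R) : (l < N)%N -> u < e < v -> is_derive e 1 (H N l) (H N l.+1 e).
  move=> lN ue; have [C C0 HC] := Fle N l.+1.
  have iCgD : nu.-integrable D (EFin \o (fun w => C * g w)).
    by apply: integrableS (iCg C C0).
  exact: (is_derive_Rintegral mD ue (iFD N l)
    (fun x w ux Dw => dF N l x w ux Dw lN) (fun w => Cg0 C w C0) iCgD HC).
have moment (e : R) : u < e < v ->
    (\int[mu (l1 + e)%R l2]_(x in [set x : R | 1 <= x]%R) (phi t x)%:E =
     \int[nu]_(w in D) (phiX w e)%:E)%E.
  move=> /zlt[_ /andP[z0 zL]].
  apply: (stationary_moment t hnu) => //; [|exact: ltW|].
  - apply: hmu => //; first exact: lt_trans L1.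
    by apply: le_lt_trans Ll2; rewrite ler_wpM2r// ltW.
  - by move=> w Dw; apply: cvg_lam_prodW (cD w Dw) => //; rewrite !ltW.
have hE N (e : R) : u < e < v -> h e = H N 0%N e.
  move=> ue; rewrite /h /H /Rintegral moment//; congr fine.
  by apply: eq_integral => w _; rewrite /F -faa0.
have hder l (e : R) : u < e < v -> derive1n l h e = H l l e.
  by move=> ue; apply: (derive1n_chain (hE l) (fun k x => @dH l k x)).
have phider w l : D w -> derive1n l (phiX w) 0 = F l l 0 w.
  move=> Dw; apply: (derive1n_phiX t l2_ge0 (cD w Dw)) => //; exact: e_in.
have phiform w l : D w -> derive1n l (phiX w) 0 = formal_derivative l1 l2 t l w.
  move=> Dw; apply: (derive1n_phiX_formal t l2_ge0 (cD w Dw)).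
  by rewrite l1_gt0.
split.
- exact: lt1_mul_of_mean_powR hlt.
- near=> e.
  have ue : u < e < v.
    near: e; have := @near_in_itvoo R u v 0; rewrite in_itv/= => /(_ u0v).
    by apply: filterS => y; rewrite in_itv.
  apply/integrableP; split.
    apply: measurable_funTS; apply/measurable_EFinP; exact: measurable_powR.
  (* Finiteness of the moment of [phi t] is transported from [nu], where order 0 of the domination
     already provides it. *)
  have /integrableP[_] := iFD 0%N 0%N e ue; congr (_ < _)%E.
  transitivity (\int[nu]_(w in D) (phiX w e)%:E)%E.
    by apply: eq_integral => w _; rewrite /F /= -faa0 ger0_norm ?powR_ge0.
  rewrite -moment//; apply: eq_integral => x _.
  by rewrite /= ger0_norm ?powR_ge0.
- apply: (smooth_at_chain u0v hE) => N l y lN uy; exact: dH.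
- exists (~` D); split; [exact: measurableC|exact: full_measureC0|].
  move=> w /= nS Dw; apply: nS.
  by apply: (smooth_at_phiX t l2_ge0 (cD w Dw)); rewrite l1_gt0.
case=> // l _; have [C C0 HC] := Fle l.+1 l.+1.
have i1 : nu.-integrable setT (EFin \o (fun w => derive1n l.+1 (phiX w) 0)).
  apply: (integrable_full mD nuD (iCg C C0)) => [w||w Dw]; first exact: Cg0.
    exact: measurable_derive1n_phiX.
  by rewrite phider// HC.
have i2 : nu.-integrable setT (EFin \o formal_derivative l1 l2 t l.+1).
  apply: (integrable_full mD nuD (iCg C C0)) => [w||w Dw]; first exact: Cg0.
    exact: measurable_formal_derivative.
  by rewrite -phiform// phider// HC.
split => //.
- rewrite hder// (Rintegral_full mD nuD i1).
  by apply: eq_Rintegral => w; rewrite inE => Dw; rewrite phider.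
- rewrite (Rintegral_full mD nuD i1) (Rintegral_full mD nuD i2).
  by apply: eq_Rintegral => w; rewrite inE => Dw; exact: phiform.
Unshelve. all: by end_near. Qed.
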